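(* Let $\alpha = \{ \alpha_g : R_{g^{-1}} \rightarrow R_g \}_{g \in \mathrm{mor}(G)}$ be a unital partial action of a groupoid $G$ on an alternative ring $R$. Then the partial skew groupoid ring $R \star_{\alpha} G$ is left (respectively right) artinian if and only if $R$ is left (respectively right) artinian and $R_g = \{0\}$ for all but finitely many $g \in \mathrm{mor}(G)$.
   Context: Rings. A ''non-associative ring'' is an additive abelian group with a multiplication that is distributive over addition; it is not assumed associative or unital. If a ring is unital, its identity is assumed non-zero. A ring $R$ is alternative if $x^2y=x(xy)$ and $xy^2=(xy)y$ for all $x,y\in R$. A left (right) ideal is an additive subgroup closed under left (right) multiplication by all ring elements; a ring is left (right) artinian if it satisfies the descending chain condition on left (right) ideals. ''Ideal'' means two-sided ideal. Groupoids. A groupoid $G$ is a small category in which all morphisms are isomorphisms; $\mathrm{ob}(G)$ and $\mathrm{mor}(G)$ are its sets of objects and morphisms, and objects are identified with their identity morphisms, so $\mathrm{ob}(G)\subseteq \mathrm{mor}(G)$. For $g\in\mathrm{mor}(G)$, $d(g)$ and $c(g)$ are its domain and codomain, and $G^2$ is the set of composable pairs $(g,h)$, i.e. those with $d(g)=c(h)$. Partial actions. A partial action of $G$ on $R$ is a family $\alpha = \{ \alpha_g : R_{g^{-1}} \to R_g \}_{g \in \mathrm{mor}(G)}$ such that for each $g$, $R_{c(g)}$ is an ideal of $R$, $R_g$ is an ideal of $R_{c(g)}$, $\alpha_g$ is a ring isomorphism, and: (P1) $\alpha_e=\mathrm{id}_{R_e}$ for $e\in\mathrm{ob}(G)$;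 (P2) if $(g,h)\in G^2$ then $R_{(gh)^{-1}}\supseteq \alpha_h^{-1}(R_h\cap R_{g^{-1}})$; (P3) if $(g,h)\in G^2$ and $x\in\alpha_h^{-1}(R_h\cap R_{g^{-1}})$ then $\alpha_g(\alpha_h(x))=\alpha_{gh}(x)$; (P4) $R=\bigoplus_{e\in\mathrm{ob}(G)}R_e$. It is unital if every non-zero $R_g$ is a unital ring. The partial skew groupoid ring $R\star_\alpha G$ is the set of finite formal sums $\sum_{g\in\mathrm{mor}(G)} r_g\delta_g$ with $r_g\in R_g$, with componentwise addition and multiplication determined by $(r_g\delta_g)(r'_h\delta_h)=\alpha_g(\alpha_{g^{-1}}(r_g)r'_h)\delta_{gh}$ if $(g,h)\in G^2$, and $0$ otherwise. *)

(* Defs.v *)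
From HB Require Import structures.
From mathcomp Require Import all_boot all_order all_algebra.
From mathcomp Require Import finmap boolp classical_sets functions cardinality.
From mathcomp Require Import monalg.

Set Implicit Arguments.
Unset Strict Implicit.
Unset Printing Implicit Defensive.

Import GRing.Theory.
Local Open Scope classical_set_scope.
Local Open Scope ring_scope.

Reserved Notation "x ** y" (at level 40, left associativity).

(* Neither associativity nor a unit is required; [GRing.PzRing] and its
   descendants are all associative and unital. *)
HB.mixin Record isNonAssocRing R of GRing.Zmodule R := {
  namul : R -> R -> R;
  namulDl : left_distributive namul +%R;
  namulDr : right_distributive namul +%R
}.

#[short(type="nonAssocRingType")]
HB.structure Definition NonAssocRing := {R of isNonAssocRing R & GRing.Zmodule R}.

Notation "x ** y" := (namul x y) : ring_scope.

Section NonAssocRingDefs.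
Variable R : nonAssocRingType.
Implicit Types (x y : R) (A B I S : set R).

Definition alternative_ring : Prop :=
  forall x y, (x ** x) ** y = x ** (x ** y) /\ x ** (y ** y) = (x ** y) ** y.

Definition additive_subgroup I : Prop :=
  I 0 /\ (forall x y, I x -> I y -> I (x - y)).

Definition left_ideal I : Prop :=
  additive_subgroup I /\ (forall r x, I x -> I (r ** x)).

Definition right_ideal I : Prop :=
  additive_subgroup I /\ (forall r x, I x -> I (x ** r)).

(* [I] is a two-sided ideal of the ring carried by the subset [S]. *)
Definition ideal_in S I : Prop :=
  [/\ I `<=` S, additive_subgroup I
    & forall s x, S s -> I x -> I (s ** x) /\ I (x ** s)].

Definition unital_on S : Prop :=
  exists u, [/\ S u, u != 0 & forall x, S x -> u ** x = x /\ x ** u = x].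

Definition ring_iso_on A B (f : R -> R) : Prop :=
  [/\ set_bij A B f, {in A &, {morph f : x y / x + y}}
    & {in A &, {morph f : x y / x ** y}}].

Definition left_artinian : Prop :=
  forall I : nat -> set R, (forall n, left_ideal (I n)) ->
    (forall n, I n.+1 `<=` I n) -> exists n, forall m, (n <= m)%N -> I m = I n.

Definition right_artinian : Prop :=
  forall I : nat -> set R, (forall n, right_ideal (I n)) ->
    (forall n, I n.+1 `<=` I n) -> exists n, forall m, (n <= m)%N -> I m = I n.

(* [{malg R[K]}] is used only as the type of finitely supported functions
   [K -> R]. *)
Definition internal_direct_sum (K : choiceType) (S : K -> set R) : Prop :=
  forall x : R, exists! s : {malg R[K]},
    (forall k, S k s@_k) /\ x = \sum_(k <- msupp s) s@_k.

End NonAssocRingDefs.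

(* [gcomp g h] is the composite "g after h"; it is a total function, whose
   value is unspecified when [gdom g != gcod h]. Objects are identified with
   their identity morphisms through the (injective) map [gid]. *)
Record groupoid := Groupoid {
  ob : choiceType;
  mor : choiceType;
  gid : ob -> mor;
  gdom : mor -> ob;
  gcod : mor -> ob;
  gcomp : mor -> mor -> mor;
  ginv : mor -> mor;
  gdom_id : forall e, gdom (gid e) = e;
  gcod_id : forall e, gcod (gid e) = e;
  gdom_comp : forall g h, gdom g = gcod h -> gdom (gcomp g h) = gdom h;
  gcod_comp : forall g h, gdom g = gcod h -> gcod (gcomp g h) = gcod g;
  gcompA : forall g h k, gdom g = gcod h -> gdom h = gcod k ->
    gcomp g (gcomp h k) = gcomp (gcomp g h) k;
  gcomp1g : forall g, gcomp (gid (gcod g)) g = g;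
  gcompg1 : forall g, gcomp g (gid (gdom g)) = g;
  gdom_inv : forall g, gdom (ginv g) = gcod g;
  gcod_inv : forall g, gcod (ginv g) = gdom g;
  gcompgV : forall g, gcomp g (ginv g) = gid (gcod g);
  gcompVg : forall g, gcomp (ginv g) g = gid (gdom g)
}.

Section GroupoidTheory.
Variable G : groupoid.
Implicit Types g h : mor G.

Lemma ginv_uniq g h : gdom g = gcod h -> gcod g = gdom h ->
  gcomp g h = gid (gcod g) -> ginv h = g.
Proof.
move=> gh hg gh1; rewrite -[RHS]gcompg1 gh -gcompgV gcompA ?gcod_inv //.
by rewrite gh1 hg -(gcod_inv h) gcomp1g.
Qed.

Lemma ginvK g : ginv (ginv g) = g.
Proof. by apply: ginv_uniq; rewrite ?gcod_inv ?gdom_inv ?gcompgV. Qed.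

Lemma ginvM g h : gdom g = gcod h ->
  ginv (gcomp (ginv h) (ginv g)) = gcomp g h.
Proof.
move=> gh.
have vhg : gdom (ginv h) = gcod (ginv g) by rewrite gdom_inv gcod_inv.
apply: ginv_uniq; rewrite ?(gdom_comp gh) ?(gcod_comp vhg) ?gcod_inv //.
  by rewrite (gcod_comp gh) (gdom_comp vhg) gdom_inv.
have ghV : gdom (gcomp g h) = gcod (ginv h) by rewrite (gdom_comp gh) gcod_inv.
have hV : gdom h = gcod (ginv h) by rewrite gcod_inv.
rewrite (gcompA ghV vhg) -(gcompA gh hV) gcompgV -gh gcompg1 gcompgV.
by rewrite (gcod_comp gh).
Qed.

End GroupoidTheory.

Definition composable (G : groupoid) (g h : mor G) : bool := gdom g == gcod h.

(* The partial isomorphism from [pa_dom (ginv g)] to [pa_dom g] is represented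
   by a total function [pa_map g] whose values outside [pa_dom (ginv g)] are
   irrelevant; accordingly, inverse images under it are intersected with
   [pa_dom (ginv g)]. *)
Record partial_action (G : groupoid) (R : nonAssocRingType) := PartialAction {
  pa_dom : mor G -> set R;
  pa_map : mor G -> R -> R;
  pa_ideal_cod : forall g, ideal_in setT (pa_dom (gid (gcod g)));
  pa_ideal : forall g, ideal_in (pa_dom (gid (gcod g))) (pa_dom g);
  pa_iso : forall g, ring_iso_on (pa_dom (ginv g)) (pa_dom g) (pa_map g);
  pa_id : forall e x, pa_dom (gid e) x -> pa_map (gid e) x = x;
  pa_comp_dom : forall g h, composable g h ->
    pa_dom (ginv h) `&` pa_map h @^-1` (pa_dom h `&` pa_dom (ginv g))
      `<=` pa_dom (ginv (gcomp g h));
  pa_comp : forall g h, composable g h -> forall x,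
    (pa_dom (ginv h) `&` pa_map h @^-1` (pa_dom h `&` pa_dom (ginv g))) x ->
    pa_map g (pa_map h x) = pa_map (gcomp g h) x;
  pa_direct_sum : internal_direct_sum (fun e => pa_dom (gid e))
}.

Definition unital_action (G : groupoid) (R : nonAssocRingType)
    (alpha : partial_action G R) : Prop :=
  forall g, pa_dom alpha g <> [set 0] -> unital_on (pa_dom alpha g).

Section SkewGroupoidRing.
Variables (G : groupoid) (R : nonAssocRingType) (alpha : partial_action G R).
Local Notation D := (pa_dom alpha).
Local Notation a := (pa_map alpha).
Local Notation formal_sum := {malg R[mor G]}.
Implicit Types (x y z : formal_sum) (g h : mor G).

Definition skew_sum : {pred formal_sum} := fun x => `[< forall g, D g x@_g >].

Lemma pa_subgroup g : additive_subgroup (D g).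
Proof. by case: (pa_ideal alpha g). Qed.

Lemma pa_dom0 g : D g 0.
Proof. by case: (pa_subgroup g). Qed.

Lemma pa_domB g r s : D g r -> D g s -> D g (r - s).
Proof. by case: (pa_subgroup g) => _; apply. Qed.

Lemma pa_domD g r s : D g r -> D g s -> D g (r + s).
Proof.
move=> Dr Ds; rewrite -[s]opprK; apply: pa_domB => //.
by rewrite -[- s]add0r; apply: pa_domB => //; apply: pa_dom0.
Qed.

Lemma pa_mapP g r : D (ginv g) r -> D g (a g r).
Proof. by case: (pa_iso alpha g) => -[+ _ _] _ _; apply. Qed.

Lemma pa_mapVP g r : D g r -> D (ginv g) (a (ginv g) r).
Proof. by move=> Dr; apply: pa_mapP; rewrite ginvK. Qed.

Lemma pa_mapD g r s : D (ginv g) r -> D (ginv g) s ->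
  a g (r + s) = a g r + a g s.
Proof. by move=> Dr Ds; case: (pa_iso alpha g) => _ + _; apply; apply/mem_set. Qed.

Lemma pa_map0 g : a g 0 = 0.
Proof.
by apply: (addrI (a g 0)); rewrite -pa_mapD ?addr0 //; apply: pa_dom0.
Qed.

Lemma pa_mapK g r : D (ginv g) r -> a (ginv g) (a g r) = r.
Proof.
move=> Dr; rewrite pa_comp; first last.
- by split=> //; split; rewrite ?ginvK; apply: pa_mapP.
- by rewrite /composable gdom_inv.
rewrite gcompVg pa_id // -gcod_inv.
by case: (pa_ideal alpha (ginv g)) => + _ _; apply.
Qed.

Lemma namul0r (T : nonAssocRingType) (r : T) : 0 ** r = 0.
Proof. by apply: (addrI (0 ** r)); rewrite -namulDl !addr0. Qed.

Lemma namulr0 (T : nonAssocRingType) (r : T) : r ** 0 = 0.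
Proof. by apply: (addrI (r ** 0)); rewrite -namulDr !addr0. Qed.

Lemma pa_mul_domV g h r s : composable g h -> D g r -> D h s ->
  D (ginv g) (a (ginv g) r ** s).
Proof.
move=> /eqP gh Dr Ds.
have [_ _ /(_ s (a (ginv g) r))[]// ] := pa_ideal alpha (ginv g).
- by rewrite gcod_inv gh; case: (pa_ideal alpha h) => + _ _; apply.
- exact: pa_mapVP.
Qed.

Lemma pa_mul_domr g h r s : composable g h -> D g r -> D h s ->
  D h (a (ginv g) r ** s).
Proof.
move=> /eqP gh Dr Ds.
have [_ _ /(_ (a (ginv g) r) s)[]// ] := pa_ideal alpha h.
rewrite -gh -gcod_inv; case: (pa_ideal alpha (ginv g)) => + _ _; apply.
exact: pa_mapVP.
Qed.

Lemma pa_mul_dom g h r s : composable g h -> D g r -> D h s ->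
  D (gcomp g h) (a g (a (ginv g) r ** s)).
Proof.
move=> gh Dr Ds; rewrite -ginvM; last exact/eqP.
have Du := pa_mul_domV gh Dr Ds.
apply: pa_comp_dom; first by rewrite /composable gdom_inv gcod_inv eq_sym.
split; first by rewrite ginvK; apply: pa_mapP.
rewrite /= pa_mapK // ginvK; split => //; exact: pa_mul_domr gh Dr Ds.
Qed.

Lemma skew_sum_zmod_closed : zmod_closed skew_sum.
Proof.
split; first by apply/asboolP => g; rewrite mcoeff0; apply: pa_dom0.
move=> x y /asboolP Dx /asboolP Dy; apply/asboolP => g.
by rewrite mcoeffB; apply: pa_domB.
Qed.

HB.instance Definition _ :=
  GRing.isZmodClosed.Build formal_sum skew_sum skew_sum_zmod_closed.

Record skew_groupoid_ring : predArgType :=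
  SkewSum { skew_val : formal_sum; _ : skew_val \in skew_sum }.

HB.instance Definition _ := [isSub for skew_val].
HB.instance Definition _ := [Choice of skew_groupoid_ring by <:].
HB.instance Definition _ := [SubChoice_isSubZmodule of skew_groupoid_ring by <:].

(* The product of the homogeneous elements [r delta_g] and [s delta_h]. *)
Definition skew_term g h (r s : R) : formal_sum :=
  if composable g h
  then << a g (a (ginv g) r ** s) *g gcomp g h >> else 0.

Definition skew_mul_sum x y : formal_sum :=
  \sum_(g <- msupp x) \sum_(h <- msupp y) skew_term g h x@_g y@_h.

Lemma skew_term0r g h r : skew_term g h 0 r = 0.
Proof. by rewrite /skew_term pa_map0 namul0r pa_map0 monalgU0 if_same. Qed.

Lemma skew_termr0 g h r : skew_term g h r 0 = 0.
Proof. by rewrite /skew_term namulr0 pa_map0 monalgU0 if_same. Qed.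

Lemma skew_termDl g h r1 r2 s : D g r1 -> D g r2 -> D h s ->
  skew_term g h (r1 + r2) s = skew_term g h r1 s + skew_term g h r2 s.
Proof.
move=> D1 D2 Ds; rewrite /skew_term; case: ifP => [gh|_]; last by rewrite addr0.
rewrite pa_mapD ?ginvK // namulDl pa_mapD ?monalgUD //.
  exact: pa_mul_domV gh D1 Ds.
exact: pa_mul_domV gh D2 Ds.
Qed.

Lemma skew_termDr g h r s1 s2 : D g r -> D h s1 -> D h s2 ->
  skew_term g h r (s1 + s2) = skew_term g h r s1 + skew_term g h r s2.
Proof.
move=> Dr D1 D2; rewrite /skew_term; case: ifP => [gh|_]; last by rewrite addr0.
rewrite namulDr pa_mapD ?monalgUD //.
  exact: pa_mul_domV gh Dr D1.
exact: pa_mul_domV gh Dr D2.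
Qed.

Lemma skew_term_sum g h r s : D g r -> D h s -> skew_term g h r s \in skew_sum.
Proof.
move=> Dr Ds; rewrite /skew_term; case: ifP => [gh|_]; last exact: rpred0.
apply/asboolP => k; rewrite mcoeffU; case: eqP => [<-|_] /=.
  exact: pa_mul_dom.
exact: pa_dom0.
Qed.

Lemma skew_mul_sum_closed x y :
  x \in skew_sum -> y \in skew_sum -> skew_mul_sum x y \in skew_sum.
Proof.
move=> /asboolP Dx /asboolP Dy.
by apply: rpred_sum => g _; apply: rpred_sum => h _; apply: skew_term_sum.
Qed.

Lemma skew_mul_sumEw (A B : {fset mor G}) x y :
  (msupp x `<=` A)%fset -> (msupp y `<=` B)%fset ->
  skew_mul_sum x y = \sum_(g <- A) \sum_(h <- B) skew_term g h x@_g y@_h.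
Proof.
move=> xA yB; rewrite /skew_mul_sum (big_fset_incl _ xA) /=; last first.
  move=> g _ /mcoeff_outdom xg0.
  by rewrite xg0 big1 // => h _; rewrite skew_term0r.
apply: eq_bigr => g _; apply: (big_fset_incl _ yB) => h _ /mcoeff_outdom ->.
exact: skew_termr0.
Qed.

Lemma skew_mul_sumU g h r s :
  skew_mul_sum << r *g g >> << s *g h >> = skew_term g h r s.
Proof.
by rewrite (skew_mul_sumEw msuppU_le msuppU_le) !big_seq_fset1 !mcoeffUU.
Qed.

Definition skew_mul (x y : skew_groupoid_ring) : skew_groupoid_ring :=
  SkewSum (skew_mul_sum_closed (valP x) (valP y)).

Lemma skew_coef (x : skew_groupoid_ring) g : D g (val x)@_g.
Proof. by have /asboolP := valP x; apply. Qed.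

Lemma skew_mulDl : left_distributive skew_mul +%R.
Proof.
move=> x y z; apply: val_inj; rewrite !raddfD /=.
pose A := (msupp (val x) `|` msupp (val y) `|` msupp (val x + val y))%fset.
have xA : (msupp (val x) `<=` A)%fset by rewrite /A -fsetUA fsubsetUl.
have yA : (msupp (val y) `<=` A)%fset.
  by apply/fsubsetP => k ky; rewrite !in_fsetU ky orbT.
have xyA : (msupp (val x + val y) `<=` A)%fset by rewrite /A fsubsetUr.
have zz := fsubset_refl (msupp (val z)).
rewrite (skew_mul_sumEw xA zz) (skew_mul_sumEw yA zz) (skew_mul_sumEw xyA zz).
rewrite -big_split /=; apply: eq_bigr => g _.
rewrite -big_split /=; apply: eq_bigr => h _.
by rewrite mcoeffD skew_termDl //; apply: skew_coef.
Qed.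

Lemma skew_mulDr : right_distributive skew_mul +%R.
Proof.
move=> z x y; apply: val_inj; rewrite !raddfD /=.
pose A := (msupp (val x) `|` msupp (val y) `|` msupp (val x + val y))%fset.
have xA : (msupp (val x) `<=` A)%fset by rewrite /A -fsetUA fsubsetUl.
have yA : (msupp (val y) `<=` A)%fset.
  by apply/fsubsetP => k ky; rewrite !in_fsetU ky orbT.
have xyA : (msupp (val x + val y) `<=` A)%fset by rewrite /A fsubsetUr.
have zz := fsubset_refl (msupp (val z)).
rewrite (skew_mul_sumEw zz xA) (skew_mul_sumEw zz yA) (skew_mul_sumEw zz xyA).
rewrite -big_split /=; apply: eq_bigr => g _.
rewrite -big_split /=; apply: eq_bigr => h _.
by rewrite mcoeffD skew_termDr //; apply: skew_coef.
Qed.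

HB.instance Definition _ :=
  isNonAssocRing.Build skew_groupoid_ring skew_mulDl skew_mulDr.

End SkewGroupoidRing.

(* Main.v *)
(** If only finitely many [R_g] are non-zero, a left ideal of the skew ring is
    controlled by the finitely many left ideals of [R] formed by its leading
    coefficients, and the chain condition passes from [R] to the skew ring.

    Conversely, a left ideal [I] of [R] yields the left ideal of all
    [\sum_g x_g delta_g] with [alpha_{g^-1}(x_g) \in I] for every [g]; here one
    uses that in an alternative ring the identity of an ideal is a central
    idempotent lying in the nucleus. So [R] is artinian and has finitely many
    primitive central idempotents [c], and the partial action permutes these
    partially. If infinitely many [R_g] were non-zero, some [c] would have an
    infinite stabilizer [H]. Over a suitable prime field [k] there is an
    additive [phi : R -> k] with [phi c = 1], and left ideals of [k[H]] induce
    left ideals of the skew ring, so that [k[H]] is artinian.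

    Connell's theorem then makes [H] finite. Let [P] be minimal among the left
    ideals of [k[H]] not contained in the augmentation ideal. Minimality forces
    the elements of [P] of augmentation [0] to be nilpotent; as the coefficient
    at the identity is a symmetric nondegenerate trace, they annihilate every
    minimal right ideal [xA]. Choosing [xA] with [p * x != 0] for some [p] in
    [P] produces a non-zero [H]-invariant element.

    The right-handed statement is the left-handed one for the opposite action
    of the opposite groupoid on the opposite ring. *)

From HB Require Import structures.
Require Import Defs.
From mathcomp Require Import all_boot all_order all_algebra.
From mathcomp Require Import finmap boolp classical_sets functions cardinality.
From mathcomp Require Import monalg.

Set Implicit Arguments.
Unset Strict Implicit.
Unset Printing Implicit Defensive.

Import Order.TTheory GRing.Theory Num.Theory.
Local Open Scope classical_set_scope.
Local Open Scope ring_scope.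

(** * Connell's theorem over a field *)

Definition dcc T (Q : set (set T)) := forall I : nat -> set T,
  (forall n, Q (I n)) -> (forall n, I n.+1 `<=` I n) ->
  exists n, forall m, (n <= m)%N -> I m = I n.

Lemma descending_subset T (I : nat -> set T) :
  (forall n, I n.+1 `<=` I n) -> forall m n, (m <= n)%N -> I n `<=` I m.
Proof.
move=> Idec m; elim=> [|n IH]; first by rewrite leqn0 => /eqP ->.
by rewrite leq_eqVlt => /predU1P[-> //|/IH nm x /Idec/nm].
Qed.

(** Without a minimal member, dependent choice would build a strictly descending sequence inside
    [F]. *)
Lemma dcc_minimal T (Q F : set (set T)) : dcc Q -> F `<=` Q -> F !=set0 ->
  exists2 M, F M & forall N, F N -> N `<=` M -> M `<=` N.
Proof.
move=> dccQ FQ [M0 FM0]; apply/not_exists2P => noM.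
have step (M : {M | F M}) : {N : {M | F M} |
    projT1 N `<=` projT1 M /\ ~ projT1 M `<=` projT1 N}.
  apply: cid; case: M => M FM /=; have [//|] := noM M.
  move=> /existsNP[N /not_implyP[FN /not_implyP[NM MN]]].
  by exists (exist _ N FN).
have [f [f0 fS]] := dependent_choice step (exist _ M0 FM0).
have [n|n|n nst] := dccQ (fun n => projT1 (f n)).
- exact/FQ/(projT2 (f n)).
- exact: (fS n).1.
- by apply: (fS n).2; rewrite -(nst n.+1).
Qed.

Section AssociativeRing.
Variable A : nzRingType.
Implicit Types (a b c x y : A).

Definition ring_left_ideal (I : set A) :=
  [/\ I 0, forall x y, I x -> I y -> I (x - y) & forall a x, I x -> I (a * x)].

Definition ring_right_ideal (I : set A) :=
  [/\ I 0, forall x y, I x -> I y -> I (x - y) & forall a x, I x -> I (x * a)].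

(** The left ideals [A * a ^+ n] descend; stability at [n] puts [a ^+ n] into [A * a ^+ n.+1]. *)
Lemma left_powers_stabilize a : dcc ring_left_ideal ->
  exists n u, a ^+ n = u * a ^+ n.+1.
Proof.
move=> dccA; have [n|n _ [b _ <-]|n nst] := dccA (fun n => range ( *%R^~ (a ^+ n))).
- split; first by exists 0; rewrite ?mul0r.
    by move=> _ _ [x _ <-] [y _ <-]; exists (x - y); rewrite // mulrBl.
  by move=> b _ [x _ <-]; exists (b * x); rewrite // mulrA.
- by exists (b * a); rewrite // -mulrA -exprS.
have : range ( *%R^~ (a ^+ n)) (a ^+ n) by exists 1; rewrite ?mul1r.
by rewrite -(nst n.+1) // => -[u _ un]; exists n, u.
Qed.

(* The minimality of [P] makes [P `&` eps @^-1` [set 0]] nil; the symmetry of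
   [tr] turns this into [(P `&` eps @^-1` [set 0]) * x = 0] for every [x]
   generating a minimal right ideal. *)
Lemma augmentation_annihilator (k : idomainType) (eps : {rmorphism A -> k})
    (tr : A -> k) (trC : forall x y, tr (x * y) = tr (y * x))
    (tr_nondeg : forall x, (forall y, tr (x * y) = 0) -> x = 0) :
  tr 0 = 0 -> dcc ring_left_ideal -> dcc ring_right_ideal ->
  exists2 x, x != 0 & forall a, eps a = 0 -> a * x = 0.
Proof.
move=> tr0 dccL dccR.
have [||P [[P0 PB PM] [p Pp p1]] Pmin] := @dcc_minimal _ _
  [set I | ring_left_ideal I /\ exists2 p, I p & eps p != 0] dccL.
- by move=> I [].
- by exists setT; split; [split|exists 1; rewrite ?rmorph1 ?oner_eq0].
have nilK y : P y -> eps y = 0 -> exists n, y ^+ n = 0.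
  move=> Py y0; have [n [u yn]] := left_powers_stabilize y dccL.
  have ynj j : exists v, y ^+ n = v * y ^+ (j + n).
    elim: j => [|j [v IH]]; first by exists 1; rewrite mul1r.
    by exists (u * v); rewrite {1}yn exprSr {1}IH addSn exprSr !mulrA.
  have [v] := ynj n.+2; rewrite addSnnS exprD => yv.
  exists n.+1.
  have Py1 : P (y ^+ n.+1) by rewrite exprSr; apply: PM.
  have ye : eps (y ^+ n.+1) = 0 by rewrite rmorphXn /= y0 expr0n.
  have yu : y ^+ n.+1 = (y * v) * (y ^+ n.+1 * y ^+ n.+1).
    by rewrite -!mulrA -yv -exprS.
  set z := y ^+ n.+1 in Py1 ye yu *.
  (* The left annihilator of [z] in [P] contains [p - p * (y * v) * z], whose augmentation is
     [eps p]. By minimality it is all of [P], so [z * z = 0]; and [z] is a left multiple of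
     [z * z]. *)
  pose Q := [set q | P q /\ q * z = 0].
  have Qid : ring_left_ideal Q.
    split; first by split; rewrite ?mul0r.
      move=> q r [Pq qz] [Pr rz]; split; first exact: PB.
      by rewrite mulrBl qz rz subrr.
    by move=> b q [Pq qz]; split; [exact: PM | rewrite -mulrA qz mulr0].
  have Qq : Q (p - p * (y * v) * z).
    split; first by apply: PB => //; apply: PM.
    by rewrite mulrBl -!mulrA [in p * _]yu !mulrA subrr.
  have PQ : P `<=` Q.
    apply: Pmin; last by move=> q [].
    split=> //; exists (p - p * (y * v) * z) => //.
    by rewrite rmorphB rmorphM ye mulr0 subr0.
  by rewrite yu; have [_ ->] := PQ _ Py1; rewrite mulr0.
have [n [u pn]] := left_powers_stabilize p dccL.
pose rspan b := range ( *%R b).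
have rspan_id b : ring_right_ideal (rspan b).
  split; first by exists 0; rewrite ?mulr0.
    by move=> _ _ [x _ <-] [y _ <-]; exists (x - y); rewrite // mulrBr.
  by move=> c _ [x _ <-]; exists (x * c); rewrite // mulrA.
(* Generators are taken in [p ^+ n * A] so that [x = u * (p * x)], which keeps [p * x] non-zero. The
   family is nonempty because [eps (p ^+ n)] is a power of [eps p] in a domain. *)
have [||M [x [x0 [z xz]] ->] xmin] := @dcc_minimal _ _
  [set M | exists2 x, x != 0 /\ (exists z, x = p ^+ n * z) & M = rspan x] dccR.
- by move=> _ [x _ ->].
- exists (rspan (p ^+ n)), (p ^+ n) => //; split; last by exists 1; rewrite mulr1.
  apply: contra_neq (expf_neq0 n p1); rewrite -rmorphXn => ->.
  exact: rmorph0.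
(* The trace of [y * x * b] is that of [x * (b * y)]. If the latter product is non-zero, it
   generates the same minimal right ideal as [x], so [x = x * (b * y) * c]; iterating brings in
   powers of the nilpotent [c * b * y]. *)
have Kx y : P y -> eps y = 0 -> y * x = 0.
  move=> Py y0; apply: tr_nondeg => b.
  have [xby0|xby0] := eqVneq (x * (b * y)) 0.
    by rewrite -mulrA trC -mulrA xby0.
  have [c _ xc] : rspan (x * (b * y)) x.
    apply: (xmin (rspan (x * (b * y)))).
    - exists (x * (b * y)) => //; split=> //.
      by exists (z * (b * y)); rewrite xz -mulrA.
    - by move=> _ [c _ <-]; exists (b * y * c); rewrite // !mulrA.
    - by exists 1; rewrite ?mulr1.
  have [m ym] : exists m, (c * b * y) ^+ m = 0.
    by apply: nilK; [exact: PM | rewrite rmorphM y0 mulr0].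
  have xj j : x = x * (b * y) * (c * b * y) ^+ j * c.
    elim: j => [|j IH]; first by rewrite mulr1.
    by rewrite exprSr -[LHS]xc {1}IH !mulrA.
  by case/eqP: x0; rewrite (xj m) ym mulr0 mul0r.
exists (p * x) => [|a a0].
  apply: contra_neq x0 => px0.
  by rewrite xz pn exprS -!mulrA -xz px0 mulr0.
by rewrite mulrA Kx //; [exact: PM | rewrite rmorphM a0 mul0r].
Qed.

End AssociativeRing.

(** * Additive maps out of a direct sum *)

Section FreeModuleExtension.
Variables (K : choiceType) (B V : zmodType).
Implicit Types (x y : {malg B[K]}) (F : K -> B -> V).

Lemma morphD0 (U W : zmodType) (f : U -> W) : {morph f : x y / x + y} -> f 0 = 0.
Proof. by move=> fD; apply: (addrI (f 0)); rewrite -fD !addr0. Qed.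

(** Monomials generate additively. Identities in the group algebra are reduced to monomials by
    applying this to one variable at a time. *)
Lemma malg_ext (f g : {malg B[K]} -> V) :
  {morph f : x y / x + y} -> {morph g : x y / x + y} ->
  (forall k c, f << c *g k >> = g << c *g k >>) -> f =1 g.
Proof.
move=> fD gD fg x; rewrite (monalgE x).
rewrite (big_morph f fD (morphD0 fD)) (big_morph g gD (morphD0 gD)).
by apply: eq_bigr => k _; apply: fg.
Qed.

Definition malg_lift F x := \sum_(k <- msupp x) F k x@_k.

Variable F : K -> B -> V.
Hypothesis FD : forall k, {morph F k : b c / b + c}.

Lemma malg_liftEw (A : {fset K}) x : (msupp x `<=` A)%fset ->
  malg_lift F x = \sum_(k <- A) F k x@_k.
Proof.
move=> xA; apply: (big_fset_incl _ xA) => k _ /mcoeff_outdom ->.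
exact: morphD0.
Qed.

Lemma malg_liftD : {morph malg_lift F : x y / x + y}.
Proof.
move=> x y; rewrite (malg_liftEw (msuppD_le x y)).
rewrite (malg_liftEw (fsubsetUl _ (msupp y))).
rewrite (malg_liftEw (fsubsetUr (msupp x) _)) -big_split /=.
by apply: eq_bigr => k _; rewrite mcoeffD FD.
Qed.

Lemma malg_liftU k c : malg_lift F << c *g k >> = F k c.
Proof. by rewrite (malg_liftEw msuppU_le) big_seq_fset1 mcoeffUU. Qed.

End FreeModuleExtension.

(** * The group algebra, its augmentation, trace and involution *)

Section GroupAlgebra.
Variables (H : groupType) (k : fieldType).

Definition group_algebra : Type := {malg k[H]}.
HB.instance Definition _ := GRing.Lmodule.on group_algebra.
Implicit Types (x y z : group_algebra) (g h : H) (c d : k).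

Definition gaU h c : group_algebra := << c *g h >>.

Lemma gaUD h : {morph gaU h : c d / c + d}.
Proof. by move=> c d; apply: monalgUD. Qed.

Definition galg_mul x y : group_algebra :=
  malg_lift (fun g c => malg_lift (fun h d => gaU (g * h)%g (c * d)) y) x.

Let mulUD g c h : {morph (fun d => gaU (g * h)%g (c * d)) : d e / d + e}.
Proof. by move=> d e; rewrite mulrDr gaUD. Qed.

Let mulU_D y g :
  {morph (fun c => malg_lift (fun h d => gaU (g * h)%g (c * d)) y) : c d / c + d}.
Proof.
move=> c d; rewrite /malg_lift -big_split; apply: eq_bigr => h _ /=.
by rewrite mulrDl gaUD.
Qed.

Lemma galg_mulDl : left_distributive galg_mul +%R.
Proof. by move=> x y z; apply: malg_liftD => g c d; apply: mulU_D. Qed.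

Lemma galg_mulDr : right_distributive galg_mul +%R.
Proof.
move=> x y z; rewrite /galg_mul -big_split; apply: eq_bigr => g _ /=.
by apply: malg_liftD => h c d; apply: mulUD.
Qed.

Lemma galg_mulUU c d g h : galg_mul (gaU g c) (gaU h d) = gaU (g * h)%g (c * d).
Proof.
rewrite /galg_mul (malg_liftU (fun g => mulU_D (gaU h d) g)).
by rewrite (malg_liftU (mulUD g c)).
Qed.

Lemma galg_ext (f g : group_algebra -> group_algebra) :
  {morph f : x y / x + y} -> {morph g : x y / x + y} ->
  (forall h c, f (gaU h c) = g (gaU h c)) -> f =1 g.
Proof. exact: malg_ext. Qed.

Lemma galg_mulA : associative galg_mul.
Proof.
move=> x y z.
move: x; apply: galg_ext => [x1 x2|x1 x2|g c]; rewrite ?galg_mulDl //.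
move: y; apply: galg_ext => [x1 x2|x1 x2|h d]; rewrite ?(galg_mulDl, galg_mulDr) //.
move: z; apply: galg_ext => [x1 x2|x1 x2|i e]; rewrite ?galg_mulDr //.
by rewrite !galg_mulUU mulrA mulgA.
Qed.

Lemma galg_mul1 : left_id (gaU 1%g 1) galg_mul.
Proof.
apply: galg_ext => [x1 x2|//|g c]; rewrite ?galg_mulDr //.
by rewrite galg_mulUU mul1r mul1g.
Qed.

Lemma galg_mulr1 : right_id (gaU 1%g 1) galg_mul.
Proof.
apply: galg_ext => [x1 x2|//|g c]; rewrite ?galg_mulDl //.
by rewrite galg_mulUU mulr1 mulg1.
Qed.

Lemma galg_1neq0 : gaU 1%g 1 != 0.
Proof. by rewrite /gaU monalgU_eq0 oner_eq0. Qed.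

HB.instance Definition _ := GRing.Zmodule_isNzRing.Build group_algebra
  galg_mulA galg_mul1 galg_mulr1 galg_mulDl galg_mulDr galg_1neq0.

Lemma gaUM c d g h : gaU g c * gaU h d = gaU (g * h)%g (c * d).
Proof. exact: galg_mulUU. Qed.

Lemma gaU1M g c x m : (gaU g c * x)@_m = c * x@_(g^-1 * m)%g.
Proof.
move: x m; suff: forall m, (fun x => (gaU g c * x)@_m) =1 (fun x => c * x@_(g^-1 * m)%g).
  by move=> E x m; apply: E.
move=> m; apply: malg_ext => [x y|x y|h d].
- by rewrite mulrDr mcoeffD.
- by rewrite mcoeffD mulrDr.
rewrite gaUM !mcoeffU mulrnAr; congr (_ *+ nat_of_bool _).
by apply/eqP/eqP => [<-|->]; rewrite ?mulKg ?mulVKg.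
Qed.

Definition galg_eps x : k := malg_lift (fun _ c => c) x.

Lemma galg_epsD : {morph galg_eps : x y / x + y}.
Proof. exact: malg_liftD. Qed.

Lemma galg_epsU h c : galg_eps (gaU h c) = c.
Proof. exact: malg_liftU. Qed.

Lemma galg_eps_zmod : zmod_morphism galg_eps.
Proof.
move=> x y; apply: (addIr (galg_eps y)); rewrite -galg_epsD !subrK //.
Qed.

Lemma galg_eps_monoid : monoid_morphism galg_eps.
Proof.
split=> [|x y]; first exact: galg_epsU.
move: x; apply: malg_ext => [x z|x z|g c].
- by rewrite mulrDl galg_epsD.
- by rewrite galg_epsD mulrDl.
move: y; apply: malg_ext => [x z|x z|h d].
- by rewrite mulrDr galg_epsD.
- by rewrite galg_epsD mulrDr.
by rewrite gaUM !galg_epsU.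
Qed.

HB.instance Definition _ := GRing.isZmodMorphism.Build _ _ galg_eps galg_eps_zmod.
HB.instance Definition _ := GRing.isMonoidMorphism.Build _ _ galg_eps galg_eps_monoid.

Definition galg_tr x : k := x@_1%g.

(** On monomials this is the equivalence of [g * h = 1] and [h * g = 1]. *)
Lemma galg_trC x y : galg_tr (x * y) = galg_tr (y * x).
Proof.
rewrite /galg_tr; move: x; apply: malg_ext => [x z|x z|g c].
- by rewrite mulrDl mcoeffD.
- by rewrite mulrDr mcoeffD.
move: y; apply: malg_ext => [x z|x z|h d].
- by rewrite mulrDr mcoeffD.
- by rewrite mulrDl mcoeffD.
rewrite !gaUM !mcoeffU mulrC; congr (_ *+ nat_of_bool _).
by apply/eqP/eqP => [/mulg1_eq<-|/mulg1_eq<-]; rewrite ?mulgV ?mulVg.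
Qed.

(** Pairing with the monomial at the inverse of [h] reads off the coefficient at [h]. *)
Lemma galg_tr_nondeg x : (forall y, galg_tr (x * y) = 0) -> x = 0.
Proof.
move=> x0; apply/malgP => h; rewrite mcoeff0.
by have := x0 (gaU h^-1%g 1); rewrite galg_trC /galg_tr gaU1M mul1r mulg1 invgK.
Qed.

(** The standard involution; being an anti-automorphism, it exchanges left and right ideals. *)
Definition galg_star x : group_algebra := malg_lift (fun h c => gaU h^-1%g c) x.

Lemma galg_starD : {morph galg_star : x y / x + y}.
Proof. by apply: malg_liftD => h; apply: gaUD. Qed.

Lemma galg_starU h c : galg_star (gaU h c) = gaU h^-1%g c.
Proof. by apply: malg_liftU => g; apply: gaUD. Qed.

Lemma galg_starK : involutive galg_star.
Proof.
apply: galg_ext => [x y|//|h c]; first by rewrite !galg_starD.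
by rewrite !galg_starU invgK.
Qed.

Lemma galg_starM x y : galg_star (x * y) = galg_star y * galg_star x.
Proof.
move: x; apply: galg_ext => [x z|x z|g c].
- by rewrite mulrDl galg_starD.
- by rewrite galg_starD mulrDr.
move: y; apply: galg_ext => [x z|x z|h d].
- by rewrite mulrDr galg_starD.
- by rewrite galg_starD mulrDl.
by rewrite gaUM !galg_starU gaUM invgM mulrC.
Qed.

Lemma galg_starB x y : galg_star (x - y) = galg_star x - galg_star y.
Proof.
by apply: (addIr (galg_star y)); rewrite -galg_starD !subrK.
Qed.

Lemma galg_right_dcc :
  dcc (@ring_left_ideal group_algebra) -> dcc (@ring_right_ideal group_algebra).
Proof.
move=> dccL I Iid Idec.
have [n|n x|n nst] := dccL (fun n => galg_star @^-1` I n).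
- have [I0 IB IM] := Iid n; split=> [|x y Ix Iy|a x Ix] /=.
  + by rewrite (morphD0 galg_starD).
  + by rewrite galg_starB; apply: IB.
  + by rewrite galg_starM; apply: IM.
- exact: Idec.
exists n => m /nst E; apply/funext => x; rewrite -[x]galg_starK.
exact: (congr1 (@^~ (galg_star x)) E).
Qed.

(* An element killed by the augmentation ideal is invariant under left
   translation, and its support is finite and nonempty. *)
Theorem artinian_group_algebra_finite :
  dcc (@ring_left_ideal group_algebra) -> finite_set [set: H].
Proof.
move=> dccL.
have [x x0 xinv] := augmentation_annihilator galg_eps galg_trC galg_tr_nondeg
  (mcoeff0 _) dccL (galg_right_dcc dccL).
have xh h m : x@_(h * m)%g = x@_m.
  have /eqP : (gaU h 1 - gaU 1%g 1) * x = 0.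
    by apply: xinv; rewrite rmorphB /= !galg_epsU subrr.
  rewrite mulrBl subr_eq0 => /eqP E.
  have := congr1 (mcoeff (h * m)%g) E.
  by rewrite !gaU1M !mul1r mulKg invg1 mul1g => ->.
have [h xh0] : exists h, h \in msupp x.
  apply/fset0Pn; apply: contra_neq x0 => x0.
  by rewrite [x]monalgE x0 big_seq_fset0.
apply: (sub_finite_set _ (finite_fset (msupp x))) => g _ /=.
by rewrite -mcoeff_neq0 -(mulgVK h g) xh mcoeff_neq0.
Qed.

End GroupAlgebra.

(** * Additive functionals to prime fields *)

(** The first hypothesis makes [p] the characteristic of [k]; the second makes [a] independent
    modulo [p V]. Zorn's lemma extends the functional given on [p V + Z a], handled through its
    graph. *)
Lemma exists_additive_functional (V : zmodType) (k : fieldType) (p : nat) (a : V) :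
  (forall n : int, (n%:~R == 0 :> k) = (p %| n)%Z) ->
  (forall v (m : int), v *+ p + a *~ m = 0 -> m%:~R = 0 :> k) ->
  exists2 phi : V -> k, {morph phi : x y / x + y} & phi a = 1.
Proof.
move=> kp ap.
pose good (E : set (V * k)) := [/\ forall u w, E u -> E w -> E (u - w),
  forall c, E (0, c) -> c = 0, forall v, E (v *+ p, 0) & E (a, 1)].
pose E0 : set (V * k) := [set u | exists v m, u = (v *+ p + a *~ m, m%:~R)].
have good0 : good E0.
  split.
  - move=> _ _ [v [m ->]] [w [n ->]]; exists (v - w), (m - n).
    by apply: injective_projections; rewrite /= ?mulrnBl mulrzBr // opprD addrACA.
  - by move=> c [v [m [/esym/ap m0 ->]]].
  - by move=> v; exists v, 0; rewrite mulr0z addr0.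
  - by exists 0, 1; rewrite mul0rn add0r.
have [F FP Ftot|E [[E_0|[EB E0c Ep Ea]] Emax]] :=
    @Zorn_bigcup _ (fun E => E = set0 \/ good E).
- have [[X FX [u Xu]]|none] := pselect (exists2 X, F X & X !=set0); last first.
    left; apply/seteqP; split=> // u [X FX Xu]; apply: none.
    by exists X => //; exists u.
  have goodF Y w : F Y -> Y w -> good Y.
    by move=> FY Yw; have [Y0|//] := FP _ FY; rewrite Y0 in Yw.
  right; split.
  + move=> w z [Y FY Yw] [Z FZ Zz].
    have [_ _ _ _] := goodF _ _ FY Yw.
    have [YZ|ZY] := Ftot _ _ FY FZ.
      by exists Z => //; have [ZB _ _ _] := goodF _ _ FZ Zz; apply: ZB => //; apply: YZ.
    by exists Y => //; have [YB _ _ _] := goodF _ _ FY Yw; apply: YB => //; apply: ZY.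
  + by move=> c [Y FY Yc]; have [_ + _ _] := goodF _ _ FY Yc; apply.
  + by move=> v; exists X => //; have [_ _ + _] := goodF _ _ FX Xu; apply.
  + by exists X => //; have [_ _ _ +] := goodF _ _ FX Xu.
- exfalso; apply: (Emax E0); last by right.
  rewrite E_0; split; first exact: sub0set.
  by move=> /(_ (a, 1)); apply; have [_ _ _] := good0.
have E00 : E 0 by rewrite -[0](subrr (a, 1)); apply: EB.
have EN u : E u -> E (- u) by rewrite -[- u]add0r; apply: EB.
have ED u w : E u -> E w -> E (u + w).
  by move=> Eu Ew; rewrite -[w]opprK; apply: EB => //; apply: EN.
have EZ u (n : int) : E u -> E (u *~ n).
  move=> Eu; have EM m : E (u *+ m).
    by elim: m => [|m IH]; rewrite ?mulr0n // mulrS; apply: ED.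
  by case: n => m; [exact: EM | rewrite NegzE mulrNz; apply/EN/EM].
have pairZ (v : V) (c : k) (n : int) : (v, c) *~ n = (v *~ n, c *~ n).
  have pairM m : (v, c) *+ m = (v *+ m, c *+ m).
    by elim: m => [|m IH]; rewrite ?mulr0n // !mulrS IH.
  by case: n => m; rewrite ?NegzE ?mulrNz -?pmulrn pairM.
have Euniq v c d : E (v, c) -> E (v, d) -> c = d.
  move=> Ec Ed; apply/eqP; rewrite -subr_eq0; apply/eqP/E0c.
  by rewrite -(subrr v); apply: (EB (v, c) (v, d)).
(* If [c] agrees with the values of [E] at multiples of [v], adjoining [(v, c)] keeps [E] good, so
   maximality already puts the pair in [E]. *)
have extend v c : (forall (n : int) d, E (v *~ n, d) -> d = n%:~R * c) -> E (v, c).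
  move=> vc; pose E' := [set w | exists u (n : int), E u /\ w = u + (v, c) *~ n].
  have EE' : E `<=` E' by move=> u Eu; exists u => //; exists 0; rewrite ?mulr0z ?addr0.
  apply: contrapT => nEvc; apply: (Emax E'); last first.
    right; split; last exact/EE'; last by move=> w; apply/EE'/Ep.
    - move=> _ _ [u [m [Eu ->]]] [w [n [Ew ->]]]; exists (u - w), (m - n).
      by split; [exact: EB | rewrite mulrzBr opprD addrACA].
    - move=> d [[w e] [n [Ew]]]; rewrite pairZ => -[/esym/eqP].
      rewrite addr_eq0 -mulrNz => /eqP wv ->; rewrite {}wv in Ew.
      by rewrite (vc _ _ Ew) mulrNz mulNr mulrzl addNr.
  split=> // E'E; apply: nEvc; apply: E'E.
  by exists 0, 1; rewrite add0r.
(* If some [n] non-zero in [k] has [v *~ n] in the domain, with value [d], then [d / n] is forced.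
   Otherwise the multiples of [v] in the domain are multiples of [v *+ p], where [E] takes the value
   0, and 0 is compatible. *)
have Etot v : exists c, E (v, c).
  have [[n [d [n0 End]]]|none] :=
    pselect (exists (n : int) d, n%:~R != 0 :> k /\ E (v *~ n, d)).
  - exists (d / n%:~R); apply: extend => m e Eme.
    apply: (mulfI n0); rewrite [d / _]mulrC mulrCA mulVKf //.
    have : E (0, n%:~R * e - m%:~R * d).
      have := EB _ _ (EZ _ n Eme) (EZ _ m End); rewrite !pairZ !mulrzl => Ez.
      by rewrite -[0](subrr (v *~ (n * m))) {1}[n * m]mulrC !mulrzA; exact: Ez.
    by move=> /E0c/eqP; rewrite subr_eq0 => /eqP.
  - exists 0; apply: extend => n d End; rewrite mulr0.
    have n0 : n%:~R = 0 :> k.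
      by apply/eqP/negPn/negP => n0; apply: none; exists n, d.
    move: n0 End => /eqP; rewrite kp => /dvdzP[q ->]; rewrite mulrzA.
    have := Ep (v *~ q); rewrite pmulrn => Eq Ed.
    by apply: Euniq Ed Eq.
have [phi phiE] := choice Etot.
exists phi; last exact: Euniq (phiE a) Ea.
by move=> x y; apply: Euniq (phiE _) _; apply: (ED (x, phi x) (y, phi y)).
Qed.

(** * Central idempotents *)

Section AdditiveMap.
Variables (U W : zmodType) (f : U -> W).
Hypothesis fD : {morph f : x y / x + y}.

Lemma morphDN x : f (- x) = - f x.
Proof. by apply: (addrI (f x)); rewrite -fD !subrr morphD0. Qed.

Lemma morphDB x y : f (x - y) = f x - f y.
Proof. by rewrite fD morphDN. Qed.

Lemma morphDMn x n : f (x *+ n) = f x *+ n.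
Proof. by elim: n => [|n IH]; rewrite ?morphD0 // !mulrS fD IH. Qed.

Lemma morphDMz x (n : int) : f (x *~ n) = f x *~ n.
Proof. by case: n => n; rewrite ?NegzE ?mulrNz ?morphDN morphDMn. Qed.

End AdditiveMap.

Lemma infinite_sequence T (A : set T) : ~ finite_set A ->
  exists2 f : nat -> T, injective f & forall n, A (f n).
Proof.
move=> /infiniteP/card_leP[f].
exists (fun n => \val (f (to_setT n))) => [m n /val_inj E|n]; last exact: set_valP.
have := @inj _ _ _ f (to_setT m) (to_setT n).
by rewrite !inE => /(_ I I E) /(congr1 val).
Qed.

Section NonAssociative.
Variable R : nonAssocRingType.
Implicit Types (c r s x y : R) (I : set R).

Lemma namulBl x y z : (x - y) ** z = x ** z - y ** z.
Proof. exact: (morphDB (fun x y => namulDl x y z)). Qed.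

Lemma namulBr x y z : x ** (y - z) = x ** y - x ** z.
Proof. exact: (morphDB (namulDr x)). Qed.

Lemma namulMzl x y (n : int) : (x *~ n) ** y = (x ** y) *~ n.
Proof. exact: (morphDMz (fun x z => namulDl x z y)). Qed.

Lemma namulMzr x y (n : int) : x ** (y *~ n) = (x ** y) *~ n.
Proof. exact: (morphDMz (namulDr x)). Qed.

Lemma namul_sumr x (J : Type) (e : seq J) (F : J -> R) :
  x ** (\sum_(j <- e) F j) = \sum_(j <- e) x ** F j.
Proof. exact: (big_morph (namul x) (namulDr x) (namulr0 x)). Qed.

Lemma namul_suml x (J : Type) (e : seq J) (F : J -> R) :
  (\sum_(j <- e) F j) ** x = \sum_(j <- e) F j ** x.
Proof.
exact: (big_morph (namul^~ x) (fun y z => namulDl y z x) (namul0r x)).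
Qed.

Lemma additive_subgroupD I x y : additive_subgroup I -> I x -> I y -> I (x + y).
Proof.
move=> [I0 IB] Ix Iy; rewrite -[y]opprK; apply: (IB) => //.
by rewrite -[- y]add0r; apply: IB.
Qed.

(** Together with commutation, the last two clauses put [c] in the left, middle and right nucleus.
    Zero is allowed. *)
Definition central_idempotent c :=
  [/\ c ** c = c, forall r, r ** c = c ** r,
      forall r s, (c ** r) ** s = c ** (r ** s)
    & forall r s, r ** (c ** s) = c ** (r ** s)].

Lemma central_idempotent0 : central_idempotent 0.
Proof. by split=> *; rewrite ?(namul0r, namulr0). Qed.

Lemma central_idempotentM c d :
  central_idempotent c -> central_idempotent d -> central_idempotent (c ** d).
Proof.
move=> [cc cC cA cL] [dd dC dA dL]; split=> [|r|r s|r s].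
- by rewrite cA cL dd -cA cc.
- by rewrite cL dC cA.
- by rewrite !cA dA.
- by rewrite !cA cL dL.
Qed.

Lemma central_idempotent_left_ideal c :
  central_idempotent c -> left_ideal (range (namul c)).
Proof.
move=> [cc cC cA cL]; split; first split.
- by exists 0; rewrite ?namulr0.
- by move=> _ _ [x _ <-] [y _ <-]; exists (x - y); rewrite ?namulBr.
- by move=> r _ [x _ <-]; exists (r ** x); rewrite ?cL.
Qed.

(** Minimality among non-zero central idempotents, stated as a dichotomy: a central idempotent kills
    [a] or fixes it. *)
Definition primitive_idempotent a := [/\ central_idempotent a, a != 0
  & forall c, central_idempotent c -> c ** a != 0 -> c ** a = a].

(** Take [a] below [c] with [a ** R] minimal. If [d ** a] is non-zero, minimality puts [a] into
    [(d ** a) ** R], on which [d] acts as the identity. *)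
Lemma primitive_idempotent_exists c : left_artinian R ->
  central_idempotent c -> c != 0 ->
  exists2 a, primitive_idempotent a & c ** a = a.
Proof.
move=> artR cid c0.
have [||_ [a [a_id a0 ca] ->] amin] := @dcc_minimal _ (@left_ideal R)
  [set I | exists2 a, [/\ central_idempotent a, a != 0 & c ** a = a]
     & I = range (namul a)] artR.
- by move=> _ [a [a_id _ _] ->]; apply: central_idempotent_left_ideal.
- by exists (range (namul c)), c => //; split=> //; case: cid.
exists a => //; split=> // d did da0.
have daid := central_idempotentM did a_id.
have [aa aC aA aL] := a_id; have [dd dC dA dL] := did.
have [r _ da] : range (namul (d ** a)) a.
  apply: amin.
  - by exists (d ** a) => //; split=> //; case: cid => _ _ _ cL; rewrite dL ca.
  - by move=> _ [r _ <-]; exists (d ** r); rewrite // dA aL.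
  - by exists a.
by rewrite -da dA -[LHS]dA dd.
Qed.

(** Distinct primitive idempotents are orthogonal. Along an infinite sequence of them the common
    annihilators of the first [n] terms descend strictly, the term [f n] dropping out at stage
    [n.+1]. *)
Lemma primitive_idempotents_finite :
  left_artinian R -> finite_set [set a | primitive_idempotent a].
Proof.
move=> artR; apply: contrapT => /infinite_sequence[f finj fprim].
have forth m n : m != n -> f m ** f n = 0.
  move=> mn; have [mid _ mP] := fprim m; have [nid _ nP] := fprim n.
  have [nm0|nm0] := eqVneq (f m ** f n) 0; first by [].
  have := nP _ mid nm0; have [_ mC _ _] := mid; rewrite -mC in nm0 *.
  by rewrite (mP _ nid nm0) => /finj mn'; rewrite mn' eqxx in mn.
have [n|n r In i ni|n nst] := artR (fun n => [set r | forall i, (i < n)%N -> f i ** r = 0]).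
- split; first split.
  + by move=> i _; rewrite namulr0.
  + by move=> x y Ix Iy i ni; rewrite namulBr Ix // Iy // subrr.
  + move=> r x Ix i ni; have [[_ _ _ iL] _ _] := fprim i.
    by rewrite -iL Ix // namulr0.
- by apply: In; apply: ltnW.
have : [set r | forall i, (i < n)%N -> f i ** r = 0] (f n).
  by move=> i ni; apply: forth; rewrite neq_ltn ni.
rewrite -(nst n.+1) // => /(_ n (ltnSn n)).
by have [[-> _ _ _] /eqP] := fprim n.
Qed.

(** The field is a prime field: [F_p] for a prime [p] dividing the additive order of [a], or the
    rationals if that order is infinite. The last clause, that scalars are fractions of integers,
    serves to replace scalars by integer multiples of an idempotent. *)
Lemma idempotent_functional a : central_idempotent a -> a != 0 ->
  exists (k : fieldType) (phi : R -> k),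
    [/\ {morph phi : x y / x + y}, phi a = 1
      & forall c : k, exists N m : int, N%:~R != 0 :> k /\ N%:~R * c = m%:~R].
Proof.
move=> [aa aC aA aL] a0.
have [[n n0 an0]|a_inf] := pselect (exists2 n, (0 < n)%N & a *+ n = 0).
  have {n n0 an0} [n [n0 an0 nmin]] : exists n, [/\ (0 < n)%N, a *+ n = 0
     & forall m, (0 < m)%N -> a *+ m = 0 -> (n <= m)%N].
    have ex : exists n, (0 < n)%N && (a *+ n == 0) by exists n; rewrite n0 an0 eqxx.
    case: (ex_minnP ex) => m /andP[m0 /eqP am] mP; exists m; split=> // j j0 aj.
    by apply: mP; rewrite j0 aj eqxx.
  have n1 : (1 < n)%N.
    by case: n n0 an0 {nmin} => [|[|n]] // _ /eqP; rewrite mulr1n (negPf a0).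
  pose p := pdiv n; have p_pr : prime p by apply: pdiv_prime.
  have chF := pchar_Fp p_pr.
  have [|v m|phi phiD phia] := @exists_additive_functional R 'F_p p a.
  - by move=> m; rewrite -(dvdz_pcharf chF).
  (* If [p] did not divide [m], Bezout would give [a = p x]. As [a] is idempotent,
     [(n / p) a = a ** (n x) = (n a) ** x = 0], against the minimality of the order [n]. *)
  - move=> vm; apply/eqP; rewrite -(dvdz_pcharf chF); apply/negPn/negP => pm.
    have /coprimezP[[u w] /= uw] : coprimez p m.
      by rewrite coprimezE /= prime_coprime.
    have ax : a = (a *~ u - v *~ w) *~ p.
      have : (v *+ p + a *~ m) *~ w = 0 by rewrite vm mul0rz.
      rewrite mulrzDl -!mulrzA pmulrn -mulrzA => /eqP.
      rewrite addrC addr_eq0 => /eqP mw.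
      rewrite mulrzBl -!mulrzA [w * p]mulrC -mw -mulrzDr.
      by rewrite [m * w]mulrC uw mulr1z.
    have pn : (n %/ p * p)%N = n by rewrite divnK // pdiv_dvd.
    have np0 : (0 < n %/ p)%N by rewrite divn_gt0 ?pdiv_gt0 // pdiv_leq.
    suff /(nmin _ np0) : a *+ (n %/ p) = 0.
      by rewrite leqNgt ltn_Pdiv ?prime_gt1.
    rewrite -aa {2}ax namulMzr pmulrn -mulrzA -PoszM mulnC pn.
    by rewrite -namulMzl -pmulrn an0 namul0r.
  exists 'F_p, phi; split=> // c; exists 1, (c : nat)%:Z; rewrite oner_eq0 mul1r.
  by split=> //; rewrite -pmulrn natr_Zp.
have [|v m|phi phiD phia] := @exists_additive_functional R rat 0 a.
- by move=> m; rewrite intr_eq0 dvd0z.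
- rewrite mulr0n add0r => am; apply/eqP; rewrite intr_eq0 -absz_eq0 eqn0Ngt.
  apply/negP => m0; apply: a_inf; exists `|m|%N => //.
  case: m am {m0} => m; first by rewrite -pmulrn.
  by rewrite NegzE mulrNz -pmulrn => /eqP; rewrite oppr_eq0 => /eqP.
exists rat, phi; split=> // c; exists (denq c), (numq c).
by rewrite intr_eq0 denq_neq0 mulrC numqE.
Qed.

End NonAssociative.

(** * Identities of ideals in alternative rings *)

Section Alternative.
Variable R : nonAssocRingType.
Hypothesis altR : alternative_ring R.
Implicit Types (u x y z : R) (D : set R).

Definition associator x y z := (x ** y) ** z - x ** (y ** z).

Lemma associatorDl x1 x2 y z :
  associator (x1 + x2) y z = associator x1 y z + associator x2 y z.
Proof. by rewrite /associator !namulDl opprD addrACA. Qed.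

Lemma associatorDm x y1 y2 z :
  associator x (y1 + y2) z = associator x y1 z + associator x y2 z.
Proof. by rewrite /associator !(namulDl, namulDr) opprD addrACA. Qed.

Lemma associatorDr x y z1 z2 :
  associator x y (z1 + z2) = associator x y z1 + associator x y z2.
Proof. by rewrite /associator !namulDr opprD addrACA. Qed.

Lemma associatorxx x z : associator x x z = 0.
Proof. by have [E _] := altR x z; rewrite /associator E subrr. Qed.

Lemma associator_xx x z : associator x z z = 0.
Proof. by have [_ E] := altR x z; rewrite /associator E subrr. Qed.

Lemma associator_swapl x y z : associator y x z = - associator x y z.
Proof.
apply/eqP; rewrite -addr_eq0; have := associatorxx (x + y) z.
rewrite associatorDl !associatorDm !associatorxx add0r addr0.
by rewrite [_ + associator y x z]addrC => ->.
Qed.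

Lemma associator_swapr x y z : associator x z y = - associator x y z.
Proof.
apply/eqP; rewrite -addr_eq0; have := associator_xx x (y + z).
rewrite associatorDm !associatorDr !associator_xx add0r addr0.
by rewrite [_ + associator x z y]addrC => ->.
Qed.

(** For [x] in [D] the associators of [r, x, u] and of [u, x, r] vanish because [u] is an identity
    on [D]; alternation then moves [u] to the other positions. *)
Lemma alternative_local_unit D u : ideal_in setT D -> D u ->
  (forall x, D x -> u ** x = x /\ x ** u = x) -> central_idempotent u.
Proof.
move=> [_ _ DM] Du uD.
have DMl r x : D x -> D (r ** x) by move=> Dx; case: (DM r x I Dx).
have DMr r x : D x -> D (x ** r) by move=> Dx; case: (DM r x I Dx).
have ul x : D x -> u ** x = x by move=> /uD[].
have ur x : D x -> x ** u = x by move=> /uD[].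
have assoc_xu r x : D x -> (r ** u) ** x = r ** x.
  move=> Dx; have : associator r x u = 0.
    by rewrite /associator (ur (r ** x)) ?(ur x) ?subrr //; apply: DMl.
  rewrite -[associator r x u]opprK -associator_swapr => /eqP.
  by rewrite oppr_eq0 /associator ul // subr_eq0 => /eqP.
have assoc_ux r x : D x -> x ** (u ** r) = x ** r.
  move=> Dx; have : associator u x r = 0.
    by rewrite /associator !ul ?subrr //; apply: DMr.
  rewrite -[associator u x r]opprK -associator_swapl => /eqP.
  by rewrite oppr_eq0 /associator ur // subr_eq0 => /eqP.
have uC r : r ** u = u ** r.
  have : associator u r u = 0 by rewrite associator_swapr associatorxx oppr0.
  rewrite /associator ur; last exact: DMr.
  by rewrite (ul (r ** u)); [move=> /eqP; rewrite subr_eq0 => /eqP -> | exact: DMl].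
(* Peirce decomposition of [r]: the part [u ** r] lies in [D], and the remainder [t] is killed by
   [u] on both sides. *)
have nuc r s : associator u r s = 0.
  have -> : r = (r - u ** r) + u ** r by rewrite subrK.
  set t := r - u ** r.
  have ut : u ** t = 0 by rewrite namulBr [u ** (_ ** _)]ul ?subrr //; apply: DMr.
  have tu : t ** u = 0.
    by rewrite namulBl [(_ ** _) ** u]ur ?uC ?subrr //; apply: DMr.
  have t0 : associator u t s = 0.
    rewrite associator_swapl /associator -(assoc_xu t (u ** s)); last exact: DMr.
    by rewrite tu !namul0r subrr oppr0.
  rewrite associatorDm t0 add0r /associator.
  by rewrite (ul (u ** r)) ?(ul (_ ** s)) ?subrr //; by [exact: DMr | exact/DMr/DMr].
split=> [|//|r s|r s]; first exact: ul.
- by have /eqP := nuc r s; rewrite subr_eq0 => /eqP.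
have : associator r u s = 0 by rewrite associator_swapl nuc oppr0.
move=> /eqP; rewrite subr_eq0 uC => /eqP <-.
by have /eqP := nuc r s; rewrite subr_eq0 => /eqP.
Qed.

End Alternative.

(** * The partial skew groupoid ring *)

Section SkewRing.
Variables (G : groupoid) (R : nonAssocRingType) (alpha : partial_action G R).
Local Notation D := (pa_dom alpha).
Local Notation a := (pa_map alpha).
Local Notation S := (skew_groupoid_ring alpha).
Implicit Types (g h k m : mor G) (e f : ob G) (r s : R) (x y : S).

Lemma gcompKg k m : gcod k = gcod m -> gcomp k (gcomp (ginv k) m) = m.
Proof.
by move=> km; rewrite gcompA ?gcod_inv ?gdom_inv // gcompgV km gcomp1g.
Qed.

Lemma gcompVKg k m : gdom k = gcod m -> gcomp (ginv k) (gcomp k m) = m.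
Proof.
by move=> km; rewrite gcompA ?gdom_inv // gcompVg km gcomp1g.
Qed.

Lemma ginv_comp g h : gdom g = gcod h ->
  ginv (gcomp g h) = gcomp (ginv h) (ginv g).
Proof. by move=> gh; rewrite -(ginvM gh) ginvK. Qed.

(** Otherwise [r] at [e] and [r] at [f] would be two decompositions of the same element. *)
Lemma pa_disjoint e f r : D (gid e) r -> D (gid f) r -> e != f -> r = 0.
Proof.
move=> er fr ef; have [s [_ sE]] := pa_direct_sum alpha r.
have dec i : D (gid i) r ->
    s = << r *g i >>.
  move=> ir; apply: sE; split=> [j|].
    rewrite mcoeffU; case: eqP => [<-//|_]; rewrite mulr0n; exact: pa_dom0.
  have := @malg_liftU _ R R (fun _ c => c) (fun _ _ _ => erefl) i r.
  by rewrite /malg_lift => ->.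
have := congr1 (mcoeff e) (etrans (esym (dec e er)) (dec f fr)).
by rewrite mcoeffUU mcoeffU eq_sym (negPf ef) mulr0n.
Qed.

Lemma pa_ideal_ob e : ideal_in setT (D (gid e)).
Proof. by have := pa_ideal_cod alpha (gid e); rewrite gcod_id. Qed.

Lemma pa_dom_cod g r : D g r -> D (gid (gcod g)) r.
Proof. by case: (pa_ideal alpha g) => + _ _; apply. Qed.

(** A product of elements of two different summands lies in both, hence is 0. So [r] acts on the
    summand at [e] through its component there. *)
Lemma pa_components r : exists t : {malg R[ob G]},
  [/\ forall e, D (gid e) t@_e, r = \sum_(e <- msupp t) t@_e
    & forall e s, D (gid e) s -> t@_e ** s = r ** s /\ s ** t@_e = s ** r].
Proof.
have [t [[tD ->] _]] := pa_direct_sum alpha r; exists t; split=> // e s es.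
have [_ _ eM] := pa_ideal_ob e.
have t0 f : f != e -> t@_f ** s = 0 /\ s ** t@_f = 0.
  move=> fe; have [_ _ fM] := pa_ideal_ob f.
  have [? ?] := eM t@_f _ I es; have [? ?] := fM s _ I (tD f).
  by split; apply: (@pa_disjoint f e).
rewrite namul_suml namul_sumr.
have [ein|eout] := boolP (e \in msupp t).
  rewrite !(bigD1_seq e) //= !big1 ?addr0 => [//|f fe|f fe].
  - exact: (t0 f fe).2.
  - exact: (t0 f fe).1.
rewrite (mcoeff_outdom eout) namul0r namulr0 !big_seq !big1 // => f ft;
  have fe : f != e by apply: contraNneq eout => <-.
- exact: (t0 f fe).2.
- exact: (t0 f fe).1.
Qed.

Lemma pa_ideal_ring g : ideal_in setT (D g).
Proof.
have [gc gB gM] := pa_ideal alpha g; split=> // r s _ gs.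
have [t [tD _ rE]] := pa_components r.
by have [<- <-] := rE _ _ (gc _ gs); apply: gM.
Qed.

Lemma pa_domMl g r s : D g s -> D g (r ** s).
Proof. by move=> gs; have [_ _ /(_ r s I gs)[]] := pa_ideal_ring g. Qed.

Lemma pa_domMr g r s : D g s -> D g (s ** r).
Proof. by move=> gs; have [_ _ /(_ r s I gs)[]] := pa_ideal_ring g. Qed.

Lemma pa_mapM g r s : D (ginv g) r -> D (ginv g) s ->
  a g (r ** s) = a g r ** a g s.
Proof. by move=> Dr Ds; case: (pa_iso alpha g) => _ _; apply; apply/mem_set. Qed.

Lemma pa_mapB g r s : D (ginv g) r -> D (ginv g) s -> a g (r - s) = a g r - a g s.
Proof.
move=> Dr Ds; apply: (addIr (a g s)); rewrite -pa_mapD ?subrK //.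
exact: pa_domB.
Qed.

Lemma pa_mapKV g r : D g r -> a g (a (ginv g) r) = r.
Proof. by move=> gr; rewrite -{1}[g]ginvK pa_mapK ?ginvK. Qed.

Lemma pa_map_inj g r s : D (ginv g) r -> D (ginv g) s -> a g r = a g s -> r = s.
Proof. by move=> Dr Ds E; rewrite -(pa_mapK Dr) E pa_mapK. Qed.

Lemma pa_map_dom k g r : composable k g -> D (ginv k) r -> D g r ->
  D (gcomp k g) (a k r).
Proof.
move=> kg Dk Dg; rewrite -ginvM; last exact/eqP.
apply: pa_comp_dom; first by rewrite /composable gdom_inv gcod_inv eq_sym.
by split; [rewrite ginvK; apply: pa_mapP | rewrite /= pa_mapK // ginvK].
Qed.

Lemma pa_map_compV k g r : composable k g -> D (ginv k) r -> D g r ->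
  a (ginv (gcomp k g)) (a k r) = a (ginv g) r.
Proof.
move=> kg Dk Dg; have /eqP kg' := kg.
rewrite pa_comp.
- by rewrite ginv_comp // -gcompA ?gdom_inv ?gcod_inv // gcompVg kg'
    -[gcod g]gdom_inv gcompg1.
- by rewrite /composable gdom_inv gcod_comp.
by split=> //; split; [exact: pa_mapP | rewrite ginvK; exact: pa_map_dom].
Qed.

Lemma skew_coefB x y g : (val (x - y))@_g = (val x)@_g - (val y)@_g.
Proof. exact: mcoeffB. Qed.

Lemma skew_coefD x y g : (val (x + y))@_g = (val x)@_g + (val y)@_g.
Proof. exact: mcoeffD. Qed.

Lemma skew_coef0 g : (val (0 : S))@_g = 0.
Proof. exact: mcoeff0. Qed.

(** The element [r delta_k], with default value 0 when [r] is not in [D k]. *)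
Definition homogeneous k r : S := insubd 0 (<< r *g k >> : {malg R[mor G]}).

Lemma val_homogeneous k r : D k r -> val (homogeneous k r) = << r *g k >>.
Proof.
move=> kr; rewrite insubdK //; apply/asboolP => g; rewrite mcoeffU.
by case: eqP => [<-//|_]; apply: pa_dom0.
Qed.

Lemma sum_homogeneous x :
  x = \sum_(k <- msupp (val x)) homogeneous k (val x)@_k.
Proof.
apply: val_inj; rewrite raddf_sum /= [LHS]monalgE; apply: eq_bigr => k _.
by rewrite val_homogeneous //; apply: skew_coef.
Qed.

(** Left composition with [k] is injective, so only the term at [h0], the composite of the inverse
    of [k] with [m], contributes at [m]. *)
Lemma coef_homogeneousM k r x m : D k r ->
  (val (homogeneous k r ** x))@_m =
  if gcod m == gcod k
  then a k (a (ginv k) r ** (val x)@_(gcomp (ginv k) m)) else 0.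
Proof.
move=> kr; rewrite [homogeneous k r ** x]/namul /= val_homogeneous //.
rewrite (skew_mul_sumEw alpha msuppU_le (fsubset_refl _)) big_seq_fset1 mcoeffUU.
rewrite raddf_sum /=; have [mk|mk] := eqVneq; last first.
  rewrite big1 // => h _; rewrite /skew_term; case: ifP => [/eqP kh|_].
    rewrite mcoeffU; case: eqP => // khm.
    by rewrite -khm gcod_comp // eqxx in mk.
  exact: mcoeff0.
set h0 := gcomp (ginv k) m.
have kh0 : gdom k = gcod h0 by rewrite gcod_comp ?gcod_inv ?gdom_inv.
have term h : h != h0 -> (skew_term alpha k h r (val x)@_h)@_m = 0.
  move=> hh0; rewrite /skew_term; case: ifP => [/eqP kh|_]; last exact: mcoeff0.
  rewrite mcoeffU; case: eqP => // khm.
  by rewrite /h0 -khm gcompVKg // eqxx in hh0.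
have term0 : (skew_term alpha k h0 r (val x)@_h0)@_m =
    a k (a (ginv k) r ** (val x)@_h0).
  by rewrite /skew_term /composable kh0 eqxx mcoeffU gcompKg // eqxx.
have [h0in|h0out] := boolP (h0 \in msupp (val x)).
  by rewrite (bigD1_seq h0) //= big1 // addr0.
rewrite (mcoeff_outdom h0out) namulr0 pa_map0 big_seq big1 // => h hin.
by apply: term; apply: contraNneq h0out => <-.
Qed.

Lemma skew_left_ideal (I : set S) : additive_subgroup I ->
  (forall k r x, D k r -> I x -> I (homogeneous k r ** x)) -> left_ideal I.
Proof.
move=> Iadd IM; split=> // y x Ix.
rewrite [y]sum_homogeneous namul_suml; elim/big_ind: _ => [|u v|k _].
- by case: Iadd.
- exact: additive_subgroupD.
- by apply: IM => //; apply: skew_coef.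
Qed.

End SkewRing.

(** * Passing the left chain condition between the base ring and the skew ring *)

Section LeftArtinian.
Variables (G : groupoid) (R : nonAssocRingType) (alpha : partial_action G R).
Local Notation D := (pa_dom alpha).
Local Notation a := (pa_map alpha).
Local Notation S := (skew_groupoid_ring alpha).
Implicit Types (g h k : mor G) (r s : R) (x y : S).

Lemma ginv_id (e : ob G) : ginv (gid e) = gid e.
Proof.
apply: ginv_uniq; rewrite ?gdom_id ?gcod_id //.
by rewrite -[e in gcomp (gid e)]gcod_id gcomp1g.
Qed.

Lemma coef_homogeneous_idM (e : ob G) r x g : D (gid e) r ->
  (val (homogeneous alpha (gid e) r ** x))@_g =
  if gcod g == e then r ** (val x)@_g else 0.
Proof.
move=> er; rewrite coef_homogeneousM // gcod_id; case: eqP => // ge.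
by rewrite -{}ge in er *; rewrite ginv_id gcomp1g !pa_id //; apply: pa_domMr.
Qed.

Lemma skew_left_artinian :
  left_artinian R -> finite_set [set g | D g <> [set 0]] -> left_artinian S.
Proof.
move=> artR /finite_fsetP[F FE] I Iid Idec.
have Imono := descending_subset Idec.
pose supp (s : seq (mor G)) x := forall g, (val x)@_g != 0 -> g \in s.
(* The chain is stabilized on elements supported in a list [s], by induction on [s]. *)
suff stab (s : seq (mor G)) : exists n, forall m, (n <= m)%N ->
    forall x, I n x -> supp s x -> I m x.
  have [n nP] := stab F; exists n => m nm; apply/seteqP; split; first exact: Imono.
  move=> x Ix; apply: nP => // g xg.
  have : [set` F] g by rewrite -FE => D0; have := skew_coef x g;
    rewrite D0 => /eqP; exact/negP.
  by [].
elim: s => [|g s [n2 IH]].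
  exists 0%N => m _ x _ x0.
  have -> : x = 0.
    apply/val_inj/malgP => g; rewrite mcoeff0; apply/eqP/negPn/negP => /x0.
    by rewrite in_nil.
  by have [[]] := Iid m.
(* Coefficients at [g] of the elements of [I n] supported in [g :: s]. Once these left ideals are
   stable, subtracting some [y] of [I m] with the same coefficient at [g] leaves an element
   supported in [s]. *)
pose J n := [set r | exists x, [/\ I n x, supp (g :: s) x & (val x)@_g = r]].
have suppB t x y : supp t x -> supp t y -> supp t (x - y).
  move=> xt yt h; rewrite skew_coefB => xyh.
  have [xh|] := eqVneq (val x)@_h 0; last exact: xt.
  by apply: yt; apply: contraNneq xyh => ->; rewrite xh subr0.
have Jid n : left_ideal (J n).
  have [[I0 IB] IM] := Iid n; split; first split.
  - by exists 0; split=> // [h|]; rewrite skew_coef0 ?eqxx.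
  - move=> _ _ [x [Ix xs <-]] [y [Iy ys <-]]; exists (x - y).
    by split; [exact: IB | exact: suppB | rewrite skew_coefB].
  move=> r _ [x [Ix xs <-]]; have [t [tD _ rE]] := pa_components alpha r.
  (* Multiplying by the component of [r] at the codomain of [g] acts as [r] on the coefficient at
     [g] and does not enlarge the support. *)
  exists (homogeneous alpha (gid (gcod g)) t@_(gcod g) ** x); split; first exact: IM.
  - move=> h; rewrite coef_homogeneous_idM //; case: ifP => [_|_]; last by rewrite eqxx.
    by apply: contraNT => hs; have [->|/xs] := eqVneq (val x)@_h 0;
      [rewrite namulr0 | rewrite (negPf hs)].
  - rewrite coef_homogeneous_idM // eqxx.
    by have [] := rE _ _ (pa_dom_cod (skew_coef x g)).
have [n|n1 n1P] := artR _ Jid.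
  by move=> _ [x [Ix xs <-]]; exists x; split=> //; apply: Idec.
exists (maxn n1 n2) => m; rewrite geq_max => /andP[n1m n2m] x Ix xs.
have In1x : I n1 x by apply: Imono Ix; apply: leq_maxl.
have : J n1 (val x)@_g by exists x.
rewrite -(n1P _ n1m) => -[y [Iy ys yg]].
rewrite -(subrK y x).
have [Iadd _] := Iid m; apply: additive_subgroupD => //; apply: IH => //.
  have [[_ IB2] _] := Iid n2; apply: IB2; last exact: Imono Iy.
  by apply: Imono Ix; apply: leq_maxr.
move=> h xyh; have := suppB _ _ _ xs ys h xyh.
rewrite inE => /predU1P[hg|//]; move: xyh.
by rewrite hg skew_coefB yg subrr eqxx.
Qed.

Hypothesis unitD : forall g,
  exists u, [/\ D g u, central_idempotent u & forall r, D g r -> u ** r = r].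

Lemma base_left_artinian : left_artinian S -> left_artinian R.
Proof.
move=> artS I Iid Idec.
pose J n : set S := [set x | forall g, I n (a (ginv g) (val x)@_g)].
have [n|n x Jx g|n nst] := artS J; first 2 last.
- exists n => m nm; apply/seteqP; split; first exact: descending_subset.
  move=> r Ir; have [t [tD rE tE]] := pa_components alpha r; rewrite rE.
  have [Iadd _] := Iid m; have [_ InM] := Iid n.
  elim/big_ind: _ => [|u v|e _]; first by case: Iadd.
    exact: additive_subgroupD.
  (* At an identity morphism the condition defining [J] is membership in [I]; the component [t@_e]
     lies in [I n] because it equals [u ** r] for the identity [u] of the summand. *)
  suff : J m (homogeneous alpha (gid e) t@_e).
    by move=> /(_ (gid e)); rewrite val_homogeneous // mcoeffUU ginv_id pa_id.
  rewrite nst // => g; rewrite val_homogeneous // mcoeffU; case: eqP => [<-|_].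
    rewrite mulr1n ginv_id pa_id //; have [u [eu _ uE]] := unitD (gid e).
    by rewrite -[t@_e]uE //; have [_ ->] := tE e u eu; apply: InM.
  by rewrite pa_map0; have [[]] := Iid n.
- have [[I0 IB] IM] := Iid n; apply: skew_left_ideal; first split.
  + by move=> g; rewrite skew_coef0 pa_map0.
  + move=> x y Jx Jy g; rewrite skew_coefB pa_mapB ?ginvK; [|exact: skew_coef..].
    exact: IB.
  move=> k r x kr Jx h; rewrite coef_homogeneousM //.
  case: eqP => [hk|_]; last by rewrite pa_map0.
  set g := gcomp (ginv k) h.
  have kg : composable k g by rewrite /composable gcod_comp ?gcod_inv ?gdom_inv.
  have <- : gcomp k g = h by apply: gcompKg.
  have gx := skew_coef x g; have kr' := pa_mapVP kr.
  rewrite pa_map_compV //; [|exact: pa_domMr|exact: pa_domMl].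
  (* Moving [u] onto the left factor brings both factors into [D g], so the inverse map yields a
     left multiple of an element of [I n]. *)
  have [u [gu [uu uC uA uL] uE]] := unitD g.
  rewrite -{1}[(val x)@_g]uE // uL -uA pa_mapM ?ginvK //; last exact: pa_domMr.
  exact/IM/Jx.
- exact/Idec/Jx.
Qed.

End LeftArtinian.

(** * The partial action on primitive idempotents *)

Section FiniteSupport.
Variables (G : groupoid) (R : nonAssocRingType) (alpha : partial_action G R).
Local Notation D := (pa_dom alpha).
Local Notation a := (pa_map alpha).
Local Notation S := (skew_groupoid_ring alpha).
Implicit Types (g h k : mor G) (c r s : R) (x y : S).

Hypothesis unitD : forall g,
  exists u, [/\ D g u, central_idempotent u & forall r, D g r -> u ** r = r].

(** Multiplication by [r] on [D g] depends only on [u ** r], which has a preimage under [a g]; the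
    identities are inherited from [c] there. *)
Lemma pa_map_central_idempotent g c : D (ginv g) c ->
  central_idempotent c -> central_idempotent (a g c).
Proof.
move=> gc [cc cC cA cL]; have [u [gu [uu uC uA uL] uE]] := unitD g.
have gac : D g (a g c) by apply: pa_mapP.
have gur r : D g (u ** r) by apply: pa_domMr.
have uMl r s : D g s -> (u ** r) ** s = r ** s.
  by move=> gs; rewrite uA uE //; apply: pa_domMl.
have uMr r s : D g s -> s ** (u ** r) = s ** r.
  by move=> gs; rewrite uL uE //; apply: pa_domMr.
have lift r : exists2 s, D (ginv g) s & a g s = u ** r.
  by exists (a (ginv g) (u ** r)); [exact: pa_mapVP | exact: pa_mapKV].
have cur r s : a g c ** (r ** s) = a g c ** ((u ** r) ** (u ** s)).
  by rewrite uMl // uL uMr.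
split=> [|r|r s|r s].
- by rewrite -pa_mapM // cc.
- have [s gs sE] := lift r.
  by rewrite -uMl // -[RHS]uMr // -sE -!pa_mapM // cC.
- have [r1 gr rE] := lift r; have [s1 gs sE] := lift s.
  rewrite cur -rE -sE -[a g c ** r]uMr // -[_ ** s]uMr; last exact: pa_domMr.
  by rewrite -rE -sE -!pa_mapM ?cA //; apply: pa_domMr.
- have [r1 gr rE] := lift r; have [s1 gs sE] := lift s.
  rewrite cur -[a g c ** s]uMr // -uMl; last exact: pa_domMr.
  by rewrite -rE -sE -!pa_mapM ?cL //; apply: pa_domMr.
Qed.

Lemma pa_map_primitive g c : D (ginv g) c ->
  primitive_idempotent c -> primitive_idempotent (a g c).
Proof.
move=> gc [cid c0 cP]; have gac := pa_mapP gc.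
split; first exact: pa_map_central_idempotent.
  by apply: contra_neq c0 => E; apply: (pa_map_inj gc (pa_dom0 _ _)); rewrite E pa_map0.
move=> d did dac0; have gdac : D g (d ** a g c) by apply: pa_domMl.
have acid := pa_map_central_idempotent gc cid.
pose b := a (ginv g) (d ** a g c).
have gb : D (ginv g) b by apply: pa_mapVP.
have bid : central_idempotent b.
  by apply: pa_map_central_idempotent (central_idempotentM did acid); rewrite ginvK.
have bE : a g b = d ** a g c by apply: pa_mapKV.
have bc : b ** c = b.
  apply: (@pa_map_inj _ _ alpha g) => //; first exact: pa_domMl.
  have [_ _ dA _] := did; have [acac _ _ _] := acid.
  by rewrite pa_mapM // bE dA acac.
rewrite -bE -{1}bc (cP b bid) // bc; apply: contra_neq dac0 => b0.
by rewrite -bE b0 pa_map0.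
Qed.

(** The identity of [D g] either fixes [c], which puts [c] in [D g], or kills it. *)
Lemma primitive_dom g c : primitive_idempotent c ->
  D g c \/ forall r, D g r -> c ** r = 0.
Proof.
move=> [cid c0 cP]; have [u [gu uid uE]] := unitD g.
have [uc0|uc0] := eqVneq (u ** c) 0; last first.
  by left; rewrite -(cP u uid uc0); apply: pa_domMr.
right=> r gr; have [uu uC uA uL] := uid.
by rewrite -[r]uE // uL -uA uc0 namul0r.
Qed.

Lemma pa_dom_ob_uniq e f c : c != 0 -> D (gid e) c -> D (gid f) c -> e = f.
Proof.
move=> c0 ec fc; apply/eqP; apply: contraNT c0 => ef.
by rewrite (pa_disjoint ec fc ef).
Qed.

Lemma pa_domMz g r (n : int) : D g r -> D g (r *~ n).
Proof.
move=> gr; have domMn (m : nat) : D g (r *+ m).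
  elim: m => [|m IH]; first exact: pa_dom0.
  by rewrite mulrS; apply: pa_domD.
case: n => n; first exact: domMn.
by rewrite NegzE mulrNz -[- _]add0r; apply: pa_domB; [exact: pa_dom0 | exact: domMn].
Qed.

Lemma pa_mapMz g r (n : int) : D (ginv g) r -> a g (r *~ n) = a g r *~ n.
Proof.
move=> gr; have mapMn (m : nat) : a g (r *+ m) = a g r *+ m.
  by elim: m => [|m IH]; rewrite ?pa_map0 // !mulrS pa_mapD ?IH //; apply: (pa_domMz m).
case: n => n; first by rewrite -!pmulrn.
rewrite NegzE !mulrNz -!pmulrn -mapMn -[- (r *+ _)]add0r.
by rewrite pa_mapB ?pa_map0 ?sub0r //; [exact: pa_dom0 | exact: (pa_domMz n.+1)].
Qed.

(** * The stabilizer group of a primitive idempotent *)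

Section Stabilizer.
Variables (c : R) (e : ob G).
Hypotheses (c_prim : primitive_idempotent c) (ec : D (gid e) c).

Definition in_stabilizer h := `[< D (ginv h) c /\ a h c = c >].
(** As [c] is non-zero, it lies in the summand of one object only; every arrow here is thus a loop
    at [e], and composition is a group law. *)
Definition stabilizer := {h | in_stabilizer h}.
HB.instance Definition _ := Choice.on stabilizer.
Implicit Types (i j : stabilizer).

Let c0 : c != 0. Proof. by case: c_prim. Qed.

Lemma stabilizerP i : D (ginv (val i)) c /\ a (val i) c = c.
Proof. by have /asboolP := valP i. Qed.

Lemma stab_dom i : D (val i) c.
Proof. by have [ic iE] := stabilizerP i; have := pa_mapP ic; rewrite iE. Qed.

Lemma stab_gcod i : gcod (val i) = e.
Proof. exact: pa_dom_ob_uniq c0 (pa_dom_cod (stab_dom i)) ec. Qed.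

Lemma gdom_source g : D (ginv g) c -> gdom g = e.
Proof.
by move=> /pa_dom_cod; rewrite gcod_inv => gc; apply: pa_dom_ob_uniq c0 gc ec.
Qed.

Lemma stab_gdom i : gdom (val i) = e.
Proof. by apply: gdom_source; case: (stabilizerP i). Qed.

Lemma stab_comp i j : composable (val i) (val j).
Proof. by rewrite /composable stab_gdom stab_gcod. Qed.

Lemma stab1_proof : in_stabilizer (gid e).
Proof. by apply/asboolP; rewrite ginv_id pa_id. Qed.

Lemma stabV_proof i : in_stabilizer (ginv (val i)).
Proof.
apply/asboolP; rewrite ginvK; split; first exact: stab_dom.
by have [ic {1}<-] := stabilizerP i; rewrite pa_mapK.
Qed.

Lemma stabM_proof i j : in_stabilizer (gcomp (val i) (val j)).
Proof.
have [ic iE] := stabilizerP i; have [jc jE] := stabilizerP j.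
have ijc : (D (ginv (val j)) `&` a (val j) @^-1` (D (val j) `&` D (ginv (val i)))) c.
  by split=> //=; rewrite jE; split=> //; apply: stab_dom.
apply/asboolP; split; first exact: pa_comp_dom (stab_comp i j) _ ijc.
by rewrite -(pa_comp (stab_comp i j) ijc) jE.
Qed.

Definition stab1 : stabilizer := Sub _ stab1_proof.
Definition stabV i : stabilizer := Sub _ (stabV_proof i).
Definition stabM i j : stabilizer := Sub _ (stabM_proof i j).

Lemma stabMA : associative stabM.
Proof.
by move=> i j l; apply: val_inj; rewrite /= gcompA //; apply/eqP/stab_comp.
Qed.

Lemma stab1M : left_id stab1 stabM.
Proof. by move=> i; apply: val_inj; rewrite /= -(stab_gcod i) gcomp1g. Qed.

Lemma stabM1 : right_id stab1 stabM.
Proof. by move=> i; apply: val_inj; rewrite /= -(stab_gdom i) gcompg1. Qed.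

Lemma stabVM : left_inverse stab1 stabV stabM.
Proof. by move=> i; apply: val_inj; rewrite /= gcompVg stab_gdom. Qed.

Lemma stabMV : right_inverse stab1 stabV stabM.
Proof. by move=> i; apply: val_inj; rewrite /= gcompgV stab_gcod. Qed.

HB.instance Definition _ := isGroup.Build stabilizer stabMA stab1M stabM1 stabVM stabMV.

Lemma val_stabM i j : val (i * j)%g = gcomp (val i) (val j).
Proof. by []. Qed.

Lemma left_artinian_stabilizer_finite :
  left_artinian S -> finite_set [set: stabilizer].
Proof.
move=> artS; have [cid _ _] := c_prim; have [cc cC cA cL] := cid.
have [k [phi0 [phi0D phi0c kint]]] := idempotent_functional cid c0.
apply: (@artinian_group_algebra_finite _ k) => L Lid Ldec.
(* The left ideal induced by [L n]: for each arrow [g] defined at [c], the coefficients of [x] along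
   the coset of [g] are cut down by [a g c], pulled back, and read by [phi]. Quantifying over all
   [phi] makes the condition stable under left multiplication. *)
pose J n : set S := [set x | forall g, D (ginv g) c ->
  forall phi : R -> k, {morph phi : r s / r + s} ->
  exists2 y, L n y & forall i : stabilizer,
    y@_i = phi (a (ginv g) (a g c ** (val x)@_(gcomp g (val i))))].
have gcD g r : D (ginv g) c -> D g (a g c ** r).
  by move=> gc; apply/pa_domMr/pa_mapP.
have Jid n : left_ideal (J n).
  have [L0 LB LM] := Lid n; apply: skew_left_ideal; first split.
  - move=> g gc phi phiD; exists 0 => // i.
    by rewrite mcoeff0 skew_coef0 namulr0 pa_map0 (morphD0 phiD).
  - move=> x y Jx Jy g gc phi phiD.
    have [u Lu uE] := Jx g gc phi phiD; have [v Lv vE] := Jy g gc phi phiD.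
    exists (u - v); first exact: LB.
    move=> i; rewrite mcoeffB uE vE -(morphDB phiD) skew_coefB namulBr pa_mapB //;
      rewrite ginvK; exact: gcD.
  move=> h r x hr Jx g gc phi phiD.
  have gdom_e := gdom_source gc.
  have gi i : gdom g = gcod (val i) by rewrite gdom_e stab_gcod.
  have zero : (forall i, a g c ** (val (homogeneous alpha h r ** x))@_(gcomp g (val i)) = 0)
      -> exists2 y, L n y & forall i : stabilizer,
    y@_i = phi (a (ginv g) (a g c ** (val (homogeneous alpha h r ** x))@_(gcomp g (val i)))).
    move=> z; exists 0 => // i.
    by rewrite mcoeff0 z pa_map0 (morphD0 phiD).
  have [gh|gh] := eqVneq (gcod g) (gcod h); last first.
    apply: zero => i; rewrite coef_homogeneousM // gcod_comp // (negPf gh).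
    exact: namulr0.
  have hr' := pa_mapVP hr.
  (* Either [a g c] annihilates [D h] and all coefficients vanish, or [a g c] lies in [D h] and [g]
     can be traded for [g']. *)
  have [hgc|gc0] := primitive_dom h (pa_map_primitive gc c_prim); last first.
    apply: zero => i; rewrite coef_homogeneousM // gcod_comp // gh eqxx.
    by apply/gc0/pa_mapP/pa_domMr.
  set g' := gcomp (ginv h) g.
  have hVg : composable (ginv h) g by rewrite /composable gdom_inv gh.
  have hg' : composable h g'.
    by rewrite /composable gcod_comp ?gcod_inv //; apply/eqP.
  have hg'E : gcomp h g' = g by apply: gcompKg.
  have gcE : (D (ginv g) `&` a g @^-1` (D g `&` D (ginv (ginv h)))) c.
    by split=> //; split; [exact: pa_mapP | rewrite ginvK].
  have g'c : D (ginv g') c := pa_comp_dom hVg gcE.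
  have g'cE : a (ginv h) (a g c) = a g' c by rewrite pa_comp.
  set d := a g' c.
  have [did _ _] : primitive_idempotent d by apply: pa_map_primitive.
  have [dd dC dA dL] := did.
  have hd : D (ginv h) d by rewrite /d -g'cE; apply: pa_mapVP.
  have g'd : D g' d by apply: pa_mapP.
  set r' := a (ginv h) r in hr'.
  set w := a (ginv g') (d ** r').
  (* The coefficient [r] is absorbed into the functional: after pulling back along [g'] it becomes
     left multiplication by [w]. *)
  have [|y Ly yE] := Jx g' g'c (fun s => phi (w ** s)).
    by move=> s t; rewrite namulDr phiD.
  exists y => // i; rewrite yE; congr phi.
  rewrite coef_homogeneousM // gcod_comp // gh eqxx -/r'.
  have -> : gcomp (ginv h) (gcomp g (val i)) = gcomp g' (val i).
    by apply: gcompA => //; exact/eqP.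
  set s := (val x)@__.
  have -> : a g c = a h d by rewrite /d -g'cE pa_mapKV.
  rewrite -pa_mapM //; last exact: pa_domMr.
  rewrite -{1}hg'E pa_map_compV //; [|exact: pa_domMr..].
  have -> : d ** (r' ** s) = (d ** r') ** (d ** s) by rewrite dA dL -[RHS]dA dd.
  by rewrite [RHS]pa_mapM ?ginvK //; apply: pa_domMr.
have [n|n nst] := artS J Jid.
  move=> x Jx g gc phi phiD; have [y Ly yE] := Jx g gc phi phiD.
  by exists y => //; apply: Ldec.
exists n => m nm; apply/seteqP; split; first exact: descending_subset.
move=> l Ll.
(* [N] is a common denominator of the coefficients of [l], and the [z i] are the numerators. *)
have [N [z [N0 zE]]] : exists (N : int) (z : stabilizer -> int), N%:~R != 0 :> k /\
    forall i, i \in (msupp l : seq _) -> N%:~R * l@_i = (z i)%:~R.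
  elim: (msupp l : seq _) => [|i s [N [z [N0 IH]]]].
    by exists 1, (fun=> 0); split=> [|i]; [exact: oner_neq0 | rewrite in_nil].
  have [M [q [M0 Mq]]] := kint l@_i.
  exists (M * N), (fun j => if j == i then N * q else M * z j).
  rewrite intrM mulf_neq0 //; split=> // j.
  rewrite inE; have [-> _|ji /= js] := eqVneq j i.
    by rewrite mulrAC Mq mulrC intrM.
  by rewrite -mulrA IH // intrM.
(* A lift of [N l] to the skew ring, with scalars replaced by integer multiples of [c]. *)
pose x : S := \sum_(i <- msupp l) homogeneous alpha (val i) (c *~ z i).
have xval g : (val x)@_g = \sum_(i <- msupp l) (c *~ z i) *+ (val i == g).
  rewrite raddf_sum raddf_sum; apply: eq_bigr => i _.
  by rewrite -mcoeffU; congr mcoeff; apply/val_homogeneous/pa_domMz/stab_dom.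
have xE i : exists2 w : int, (val x)@_(val i) = c *~ w & N%:~R * l@_i = w%:~R.
  rewrite xval; have [il|il] := boolP (i \in msupp l).
    exists (z i); last exact: zE.
    rewrite (bigD1_seq i il (fset_uniq _)) /= eqxx big1 ?addr0 // => j ji.
    by rewrite val_eqE (negPf ji).
  exists 0; last by rewrite (mcoeff_outdom il) mulr0.
  rewrite big_seq big1 // => j jl; rewrite val_eqE; case: eqP => // ji.
  by rewrite -ji jl in il.
have xout g : (forall i, g <> val i) -> (val x)@_g = 0.
  by move=> gout; rewrite xval big1 // => i _; case: eqP => // /esym/gout.
have : J m x.
  rewrite nst // => g gc phi phiD.
  (* If [g] moves [c], its coset misses the support of [x], and 0 serves. If [g] fixes [c], the
     readings form a scalar multiple of a translate of [l]. *)
  have [gstab|gstab] := pselect (a g c = c); last first.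
    exists 0 => [|i]; first by have [] := Lid n.
    rewrite xout ?namulr0 ?pa_map0 ?mcoeff0 ?(morphD0 phiD) // => j gij.
    apply: gstab.
    have gi : gdom g = gcod (val i) by rewrite (gdom_source gc) stab_gcod.
    have -> : g = val (j * i^-1)%g.
      rewrite val_stabM -gij -gcompA ?gcod_inv //= gcompgV -gi.
      by rewrite gcompg1.
    by have [] := stabilizerP (j * i^-1)%g.
  have gin : in_stabilizer g by apply/asboolP.
  pose i0 : stabilizer := Sub g gin.
  exists (gaU i0^-1%g (phi c * N%:~R) * l) => [|i].
    by have [_ _ +] := Lid n; apply.
  rewrite gaU1M invgK -mulrA; have [w -> ->] := xE (i0 * i)%g.
  have gVc : a (ginv g) c = c by rewrite -{1}gstab pa_mapK.
  rewrite gstab namulMzr cc pa_mapMz ?gVc; last first.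
    by rewrite ginvK -gstab; apply: pa_mapP.
  by rewrite (morphDMz phiD) mulrzr.
have eVc : D (ginv (gid e)) c by rewrite ginv_id.
(* At the identity morphism, with [phi0 c = 1], the reading of [x] is [N l]; dividing by [N]
   recovers [l]. *)
move=> /(_ (gid e) eVc phi0 phi0D) [y Ly yE].
have [_ _ /(_ (gaU 1%g N%:~R^-1) y Ly)] := Lid m.
congr (L m _); apply/malgP => i; rewrite gaU1M yE ginv_id invg1 mul1g.
rewrite -(stab_gcod i) gcomp1g stab_gcod [a (gid e) c]pa_id // pa_id; last exact: pa_domMr.
have [w -> wE] := xE i; rewrite namulMzr cc (morphDMz phi0D) phi0c -wE.
by rewrite mulKf.
Qed.

End Stabilizer.

(** Each non-zero [D g] contains the image of some primitive idempotent. There are finitely many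
    pairs of source and image, and the arrows realizing a given pair form one coset of a
    stabilizer. *)
Lemma left_artinian_finite_support :
  left_artinian R -> left_artinian S -> finite_set [set g | D g <> [set 0]].
Proof.
move=> artR artS; have Pfin := primitive_idempotents_finite artR.
set P := [set c | primitive_idempotent c] in Pfin.
pose fiber (p : R * R) := [set g | D (ginv g) p.1 /\ a g p.1 = p.2].
apply: (@sub_finite_set _ _ (\bigcup_(p in P `*` P) fiber p)).
  move=> g Dg.
  have [s gs s0] : exists2 s, D (ginv g) s & s != 0.
    apply: contrapT => none; apply: Dg; apply/seteqP; split=> [r gr|_ ->]; last exact: pa_dom0.
    apply: contrapT => r0; apply: none; exists (a (ginv g) r); first exact: pa_mapVP.
    by apply/eqP => E; apply: r0; rewrite /= -[r](pa_mapKV gr) E pa_map0.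
  have [u [gu uid uE]] := unitD (ginv g).
  have u0 : u != 0 by apply: contra_neq s0 => u0; rewrite -[s]uE // u0 namul0r.
  have [c cprim uc] := primitive_idempotent_exists artR uid u0.
  have gc : D (ginv g) c by rewrite -uc; apply: pa_domMr.
  by exists (c, a g c); split=> //=; apply: pa_map_primitive.
apply: bigcup_finite => [|[c b] [/= cprim bprim]]; first exact: finite_setX.
have [[g0 [/= g0c g0b]]|none] := pselect (fiber (c, b) !=set0); last first.
  by rewrite (_ : fiber _ = set0) //; apply/seteqP; split=> // g gf; apply: none; exists g.
have ec : D (gid (gdom g0)) c by rewrite -gcod_inv; apply: pa_dom_cod.
have stabfin := left_artinian_stabilizer_finite cprim ec artS.
apply: (@sub_finite_set _ _ ((fun i : stabilizer c => gcomp g0 (val i)) @` setT)).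
  move=> g [/= gc gb]; have [_ b0 _] := bprim.
  have gg0 : gcod g = gcod g0.
    apply: (@pa_dom_ob_uniq _ _ b) => //; apply: pa_dom_cod.
      by rewrite -gb; apply: pa_mapP.
    by rewrite -g0b; apply: pa_mapP.
  have g0g : composable (ginv g0) g by rewrite /composable gdom_inv gg0.
  have cE : (D (ginv g) `&` a g @^-1` (D g `&` D (ginv (ginv g0)))) c.
    split=> //; split; first exact: pa_mapP.
    by rewrite ginvK gb -g0b; apply: pa_mapP.
  have gin : in_stabilizer c (gcomp (ginv g0) g).
    apply/asboolP; split; first exact: pa_comp_dom g0g _ cE.
    by rewrite -(pa_comp g0g cE) gb -g0b pa_mapK.
  by exists (Sub _ gin : stabilizer c) => //=; apply: gcompKg.
exact: finite_image.
Qed.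

End FiniteSupport.

(** * Opposites *)

Lemma anti_isomorphism_artinian (A B : nonAssocRingType) (f : A -> B) (f' : B -> A) :
  cancel f f' -> cancel f' f -> {morph f : x y / x + y} ->
  (forall x y, f (x ** y) = f y ** f x) -> right_artinian A <-> left_artinian B.
Proof.
move=> fK f'K fD fM.
have f'D : {morph f' : x y / x + y}.
  by move=> x y; apply: (can_inj fK); rewrite fD !f'K.
have f'M x y : f' (x ** y) = f' y ** f' x.
  by apply: (can_inj fK); rewrite fM !f'K.
split=> art I Iid Idec.
- have [n|n x|n nst] := art (fun n => f @^-1` I n).
  + have [[I0 IB] IM] := Iid n; split; first split.
    * by rewrite /= (morphD0 fD).
    * by move=> x y /= Ix Iy; rewrite (morphDB fD); apply: IB.
    * by move=> r x /= Ix; rewrite fM; apply: IM.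
  + exact: Idec.
  exists n => m /nst E; apply/funext => x; rewrite -[x]f'K.
  exact: (congr1 (@^~ (f' x)) E).
- have [n|n x|n nst] := art (fun n => f' @^-1` I n).
  + have [[I0 IB] IM] := Iid n; split; first split.
    * by rewrite /= (morphD0 f'D).
    * by move=> x y /= Ix Iy; rewrite (morphDB f'D); apply: IB.
    * by move=> r x /= Ix; rewrite f'M; apply: IM.
  + exact: Idec.
  exists n => m /nst E; apply/funext => x; rewrite -[x]fK.
  exact: (congr1 (@^~ (f x)) E).
Qed.

Definition opposite_ring (R : nonAssocRingType) : Type := R.

Section OppositeRing.
Variable R : nonAssocRingType.
HB.instance Definition _ := GRing.Zmodule.on (opposite_ring R).
HB.instance Definition _ := isNonAssocRing.Build (opposite_ring R)
  (fun x y z => namulDr z x y) (fun x y z => namulDl y z x).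

Lemma opposite_ring_alternative :
  alternative_ring R -> alternative_ring (opposite_ring R).
Proof. by move=> altR x y; have [yyx yxx] := altR y x. Qed.

Lemma opposite_ring_artinian : right_artinian R <-> left_artinian (opposite_ring R).
Proof. exact: (@anti_isomorphism_artinian R (opposite_ring R) id id). Qed.

Lemma opposite_ideal (A I : set R) :
  ideal_in A I -> @ideal_in (opposite_ring R) A I.
Proof. by move=> [IA Iadd IM]; split=> // s x As Ix; have [] := IM s x As Ix. Qed.

End OppositeRing.

Section OppositeAction.
Variables (G : groupoid) (R : nonAssocRingType) (alpha : partial_action G R).
Local Notation D := (pa_dom alpha).
Local Notation a := (pa_map alpha).
Local Notation Rop := (opposite_ring R).

Definition opposite_groupoid : groupoid.
Proof.
refine (@Groupoid (ob G) (mor G) (@gid G) (@gcod G) (@gdom G)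
  (fun g h => gcomp h g) (@ginv G) _ _ _ _ _ _ _ _ _ _ _).
- exact: gcod_id.
- exact: gdom_id.
- by move=> g h /esym; apply: gcod_comp.
- by move=> g h /esym; apply: gdom_comp.
- by move=> g h k /esym gh /esym hk; rewrite gcompA.
- exact: gcompg1.
- exact: gcomp1g.
- exact: gcod_inv.
- exact: gdom_inv.
- exact: gcompVg.
- exact: gcompgV.
Defined.

(** The codomain of [g] in the opposite groupoid is its original domain, so the ideal attached to
    [g] has to be [D (ginv g)]. *)
Definition opposite_action : partial_action opposite_groupoid Rop.
Proof.
refine (@PartialAction opposite_groupoid Rop (fun g => D (ginv g))
  (fun g => a (ginv g)) _ _ _ _ _ _ _) => /=.
- by move=> g; apply: opposite_ideal; rewrite ginv_id; apply: pa_ideal_ob.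
- move=> g; apply: opposite_ideal; rewrite ginv_id -gcod_inv.
  exact: pa_ideal.
- move=> g; have [bij fD fM] := pa_iso alpha (ginv g); split=> // x y Dx Dy.
  exact: fM.
- by move=> e x; rewrite ginv_id; apply: pa_id.
- move=> g h gh; have ghV : composable (ginv g) (ginv h).
    by rewrite /composable gdom_inv gcod_inv.
  have gh' : gdom h = gcod g := esym (eqP gh).
  by rewrite (ginv_comp gh'); exact: (@pa_comp_dom _ _ alpha _ _ ghV).
- move=> g h gh x; have ghV : composable (ginv g) (ginv h).
    by rewrite /composable gdom_inv gcod_inv.
  have gh' : gdom h = gcod g := esym (eqP gh).
  by rewrite (ginv_comp gh'); exact: (@pa_comp _ _ alpha _ _ ghV).
- have -> : (fun e => D (ginv (gid e))) = (fun e => D (gid e)).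
    by apply/funext => e; rewrite ginv_id.
  exact: (pa_direct_sum alpha).
Defined.

End OppositeAction.

Lemma homogeneousM (G : groupoid) (R : nonAssocRingType)
    (alpha : partial_action G R) g h r s :
  pa_dom alpha g r -> pa_dom alpha h s ->
  homogeneous alpha g r ** homogeneous alpha h s =
  if composable g h then homogeneous alpha (gcomp g h)
    (pa_map alpha g (pa_map alpha (ginv g) r ** s)) else 0.
Proof.
move=> gr hs; apply: val_inj; rewrite [LHS]/= !val_homogeneous // skew_mul_sumU.
rewrite /skew_term; case: ifP => // gh; rewrite val_homogeneous //.
exact: pa_mul_dom.
Qed.

Lemma coef_sum_homogeneous (G : groupoid) (R : nonAssocRingType)
    (alpha : partial_action G R) (F : {fset mor G}) (w : mor G -> R) g :
  (forall h, pa_dom alpha h (w h)) -> (g \notin F -> w g = 0) ->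
  (val (\sum_(h <- F) homogeneous alpha h (w h)))@_g = w g.
Proof.
move=> wD w0; rewrite raddf_sum raddf_sum /=.
have term h : (val (homogeneous alpha h (w h)))@_g = w h *+ (h == g).
  by rewrite val_homogeneous // mcoeffU.
have [gF|gF] := boolP (g \in F); last first.
  rewrite (w0 gF) big_seq big1 // => h hF.
  by apply: etrans (term h) _; case: eqP => // hg; rewrite -hg hF in gF.
rewrite (bigD1_seq g gF (fset_uniq _)) /= big1 ?addr0 => [|h hg].
  by apply: etrans (term g) _; rewrite eqxx.
by apply: etrans (term h) _; rewrite (negPf hg).
Qed.

Section OppositeSkewRing.
Variables (G : groupoid) (R : nonAssocRingType).

(** This amounts to moving the coefficient to the right of [delta_g], which replaces it by its image
    under [pa_map alpha (ginv g)]. *)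
Definition opposite_skew (alpha : partial_action G R)
  (x : skew_groupoid_ring alpha) : skew_groupoid_ring (opposite_action alpha) :=
  \sum_(g <- msupp (val x))
    homogeneous (opposite_action alpha) g (pa_map alpha (ginv g) (val x)@_g).

Definition opposite_skew_inv (alpha : partial_action G R)
  (x : skew_groupoid_ring (opposite_action alpha)) : skew_groupoid_ring alpha :=
  \sum_(g <- msupp (val x)) homogeneous alpha g (pa_map alpha g (val x)@_g).

Variable alpha : partial_action G R.
Local Notation D := (pa_dom alpha).
Local Notation a := (pa_map alpha).
Local Notation beta := (opposite_action alpha).

Lemma coef_opposite_skew (x : skew_groupoid_ring alpha) g :
  (val (opposite_skew x))@_g = a (ginv g) (val x)@_g.
Proof.
rewrite (@coef_sum_homogeneous _ _ beta _ (fun g => a (ginv g) (val x)@_g)) // => [h|gx].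
  exact/pa_mapVP/skew_coef.
by rewrite (mcoeff_outdom gx) pa_map0.
Qed.

Lemma coef_opposite_skew_inv (x : skew_groupoid_ring beta) g :
  (val (opposite_skew_inv x))@_g = a g (val x)@_g.
Proof.
rewrite (@coef_sum_homogeneous _ _ alpha _ (fun g => a g (val x)@_g)) // => [h|gx].
  exact: (pa_mapP (skew_coef x h)).
by rewrite (@mcoeff_outdom _ R _ _ gx) pa_map0.
Qed.

Lemma opposite_skewD : {morph @opposite_skew alpha : x y / x + y}.
Proof.
move=> x y; apply/val_inj/malgP => g.
rewrite skew_coefD !coef_opposite_skew (@skew_coefD G R alpha).
by rewrite (@pa_mapD G R alpha) ?ginvK //; apply: (@skew_coef G R alpha).
Qed.

Lemma opposite_skew_homogeneous g r : D g r ->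
  opposite_skew (homogeneous alpha g r) = homogeneous beta g (a (ginv g) r).
Proof.
move=> gr; apply/val_inj/malgP => h; rewrite coef_opposite_skew.
rewrite (@val_homogeneous G R alpha) // (@mcoeffU _ R).
have grV : pa_dom beta g (a (ginv g) r) by apply: pa_mapVP.
rewrite (val_homogeneous grV) (@mcoeffU _ R).
by case: eqP => [<-//|_]; exact: (pa_map0 alpha).
Qed.

Lemma opposite_skewM x y :
  opposite_skew (x ** y) = opposite_skew y ** @opposite_skew alpha x.
Proof.
have homM g h r s : D g r -> D h s ->
    opposite_skew (homogeneous alpha g r ** homogeneous alpha h s) =
    opposite_skew (homogeneous alpha h s) ** opposite_skew (homogeneous alpha g r).
  move=> gr hs; rewrite !opposite_skew_homogeneous // !homogeneousM //; first last.
  - exact: pa_mapVP.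
  - exact: pa_mapVP.
  have -> : @composable (opposite_groupoid G) h g = composable g h.
    by rewrite /composable eq_sym.
  case: ifP => [gh|_]; last exact: morphD0 opposite_skewD.
  rewrite opposite_skew_homogeneous; last exact: pa_mul_dom.
  (* Both coefficients equal [a (ginv h) (a (ginv g) r ** s)]. *)
  congr homogeneous.
  rewrite pa_map_compV //; [|exact: pa_mul_domV hs|exact: pa_mul_domr hs].
  by rewrite /= [a (ginv (ginv h)) _]pa_mapK ?ginvK.
have additive_sum (I : choiceType) (F : {fset I}) (w : I -> skew_groupoid_ring alpha) :
    opposite_skew (\sum_(i <- F) w i) = \sum_(i <- F) opposite_skew (w i).
  exact: (big_morph _ opposite_skewD (morphD0 opposite_skewD)).
rewrite [x]sum_homogeneous [y]sum_homogeneous.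
rewrite namul_suml !additive_sum namul_sumr; apply: eq_bigr => g _.
rewrite namul_sumr additive_sum namul_suml; apply: eq_bigr => h _.
by apply: homM; apply: skew_coef.
Qed.

Lemma opposite_skewK : cancel (@opposite_skew alpha) (@opposite_skew_inv alpha).
Proof.
move=> x; apply/val_inj/malgP => g.
rewrite coef_opposite_skew_inv coef_opposite_skew pa_mapKV //.
exact: skew_coef.
Qed.

Lemma opposite_skew_invK : cancel (@opposite_skew_inv alpha) (@opposite_skew alpha).
Proof.
move=> x; apply/val_inj/malgP => g.
rewrite coef_opposite_skew coef_opposite_skew_inv pa_mapK //.
exact: (skew_coef x g).
Qed.

Lemma skew_right_artinian : right_artinian (skew_groupoid_ring alpha) <->
  left_artinian (skew_groupoid_ring beta).
Proof.
exact: anti_isomorphism_artinian opposite_skewK opposite_skew_invK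
  opposite_skewD opposite_skewM.
Qed.

End OppositeSkewRing.

(** For a zero ideal, where unitality says nothing, the idempotent is 0. *)
Lemma pa_unit (G : groupoid) (R : nonAssocRingType) (alpha : partial_action G R) :
  alternative_ring R -> unital_action alpha -> forall g, exists u,
    [/\ pa_dom alpha g u, central_idempotent u
      & forall r, pa_dom alpha g r -> u ** r = r].
Proof.
move=> altR unitalA g; have [D0|Dn0] := pselect (pa_dom alpha g = [set 0]).
  exists 0; split=> [||r]; [by rewrite D0|exact: central_idempotent0|].
  by rewrite D0 => ->; rewrite namul0r.
have [u [gu _ uE]] := unitalA g Dn0; exists u; split=> // [|r /uE[]//].
exact: alternative_local_unit (pa_ideal_ring alpha g) gu uE.
Qed.

Lemma left_artinian_criterion (G : groupoid) (R : nonAssocRingType)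
    (alpha : partial_action G R) :
  alternative_ring R -> unital_action alpha ->
  left_artinian (skew_groupoid_ring alpha) <->
  left_artinian R /\ finite_set [set g : mor G | pa_dom alpha g <> [set 0]].
Proof.
move=> altR unitalA; have unitD := pa_unit altR unitalA.
split=> [artS|[artR finD]]; last exact: skew_left_artinian.
have artR := base_left_artinian unitD artS.
by split=> //; apply: left_artinian_finite_support.
Qed.

Lemma pa_dom_inv_trivial (G : groupoid) (R : nonAssocRingType)
    (alpha : partial_action G R) g :
  pa_dom alpha g = [set 0] -> pa_dom alpha (ginv g) = [set 0].
Proof.
move=> D0; apply/seteqP; split=> [r gr|_ ->]; last exact: pa_dom0.
have : pa_dom alpha g (pa_map alpha g r) by apply: pa_mapP.
rewrite D0 => /= r0; rewrite /= -(pa_mapK gr) r0; exact: pa_map0.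
Qed.

Theorem theorem1p3 (G : groupoid) (R : nonAssocRingType)
    (hR : alternative_ring R)
    (alpha : partial_action G R) (halpha : unital_action alpha) :
  (left_artinian (skew_groupoid_ring alpha) <->
     left_artinian R /\ finite_set [set g : mor G | pa_dom alpha g <> [set 0]])
  /\
  (right_artinian (skew_groupoid_ring alpha) <->
     right_artinian R /\ finite_set [set g : mor G | pa_dom alpha g <> [set 0]]).
Proof.
split; first exact: left_artinian_criterion.
have unitalV : unital_action (opposite_action alpha).
  move=> g /= Dg; have [u [gu u0 uE]] := halpha _ Dg; exists u; split=> // r gr.
  by have [] := uE r gr.
(* The opposite action carries [D (ginv g)] at [g]; the ideals at [g] and at its inverse vanish
   together. *)
have suppE : [set g : mor G | pa_dom alpha g <> [set 0]] =
    [set g : mor G | pa_dom alpha (ginv g) <> [set 0]].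
  apply/seteqP; split=> g /= Dg D0; apply: Dg; last exact: pa_dom_inv_trivial.
  by rewrite -[g]ginvK; apply: pa_dom_inv_trivial.
have := left_artinian_criterion (opposite_ring_alternative hR) unitalV.
by rewrite skew_right_artinian opposite_ring_artinian suppE.
Qed.
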